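(* Let $A$ be a nonnegative selfadjoint linear relation in a complex Hilbert space $\mathcal H$ and let $\mathcal L$ be a closed subspace of $\mathcal H$. Then $$A_{\mathcal L}\le\big((A^{-1})_{\mathcal L}\big)^{-1}.$$ Moreover, let $$\mathcal M_{A,\mathcal L}(\lambda):=-\big(P_{\mathcal L}(A-\lambda I)^{-1}\upharpoonright\mathcal L\big)^{-1}-\lambda I_{\mathcal L},\qquad \lambda\in\rho(A),$$ where $P_{\mathcal L}$ is the orthogonal projection onto $\mathcal L$. Then, with $\lambda$ running along the negative real axis, $$A_{\mathcal L}\upharpoonright\mathcal L=-\Big(\operatorname{s-R-}\lim_{\lambda\uparrow0}\mathcal M_{A,\mathcal L}(\lambda)\Big),\qquad \big((A^{-1})_{\mathcal L}\upharpoonright\mathcal L\big)^{-1}=-\Big(\operatorname{s-R-}\lim_{\lambda\downarrow-\infty}\mathcal M_{A,\mathcal L}(\lambda)\Big).$$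
   Context: A linear relation (l.r.) in $\mathcal H$ is a closed linear subspace $A=\{\{f,f'\}\}$ of $\mathcal H\oplus\mathcal H$; $\operatorname{dom}A$, $\operatorname{ran}A$ are the sets of first, resp. second, components; $\operatorname{mul}A=\{f':\{0,f'\}\in A\}$; $A^{-1}=\{\{f',f\}:\{f,f'\}\in A\}$; $-A=\{\{f,-f'\}\}$; $A+cI=\{\{f,f'+cf\}\}$. $A$ is selfadjoint if $A=A^*:=\{\{g,g'\}:(f',g)=(f,g')\ \forall\{f,f'\}\in A\}$, nonnegative if $(f',f)\ge0$ for all $\{f,f'\}\in A$. $A\upharpoonright\mathcal L:=\{\{f,f'\}\in A:f\in\operatorname{dom}A\cap\mathcal L\}$. A nonnegative selfadjoint l.r. decomposes as $A=\mathrm{Graph}(A_o)\oplus(\{0\}\oplus\operatorname{mul}A)$ with $A_o$ a nonnegative selfadjoint operator in $\mathcal H\ominus\operatorname{mul}A$; its closed form is $A[\varphi]=\|A_o^{1/2}\varphi\|^2$, $\varphi\in\mathcal D[A]=\operatorname{dom}A_o^{1/2}$. $\rho(A)$ denotes $\rho(A_o)$, and $(A-\lambda I)^{-1}f=(A_o-\lambda I)^{-1}P f$ with $P$ the orthogonal projection onto $\mathcal H\ominus\operatorname{mul}A$. The order $A_1\ge A_2$ means $\mathcal D[A_1]\subseteq\mathcal D[A_2]$ and $A_1[\varphi]\ge A_2[\varphi]$ for all $\varphi\in\mathcal D[A_1]$. For a closed subspace $\mathcal L$, $A_{\mathcal L}$ denotes the (existing, unique) maximal element of the set of nonnegative selfadjoint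 l.r. $\widetilde A$ in $\mathcal H$ with $\widetilde A\le A$ and $\operatorname{ran}\widetilde A\subseteq\mathcal L$. One has $\ker A_{\mathcal L}\supseteq\mathcal L^\perp$, so $A_{\mathcal L}\upharpoonright\mathcal L$ is a nonnegative selfadjoint l.r. in $\mathcal L$. For $\lambda<0$ the relation $-\mathcal M_{A,\mathcal L}(\lambda)$ is a nonnegative selfadjoint l.r. in $\mathcal L$. For nonnegative selfadjoint l.r., $\operatorname{s-R-}\lim B_\lambda=B$ means $(B_\lambda+I)^{-1}\to(B+I)^{-1}$ strongly; the limits of $\mathcal M_{A,\mathcal L}(\lambda)$ are understood via $-\big(\operatorname{s-R-}\lim\mathcal M_{A,\mathcal L}(\lambda)\big)=\operatorname{s-R-}\lim\big(-\mathcal M_{A,\mathcal L}(\lambda)\big)$. *)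

(* Defs.v *)
From HB Require Import structures.
From mathcomp Require Import all_boot all_order all_algebra.
From mathcomp Require Import complex.
From mathcomp Require Import all_classical all_reals topology normedtype.

Set Implicit Arguments.
Unset Strict Implicit.
Unset Printing Implicit Defensive.

Import Order.TTheory GRing.Theory Num.Theory.
Import numFieldNormedType.Exports.

Local Open Scope classical_set_scope.
Local Open Scope ring_scope.

(* Complex Hilbert spaces; the inner product is linear in its first argument. *)
HB.mixin Record CompleteNormedModule_isHilbert (R : realType) H
    of CompleteNormedModule R[i] H := {
  inner : {dot H for (@Num.conj R[i])} ;
  inner_norm : forall x : H, inner x x = `|x| ^+ 2
}.

#[short(type="hilbertType")]
HB.structure Definition Hilbert (R : realType) :=
  {H of CompleteNormedModule R[i] H & CompleteNormedModule_isHilbert R H}.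

Notation "''[' u , v ]" := (inner u v)
  (at level 0, format "''[' u ,  v ]") : ring_scope.

Definition closed_subspace (R : realType) (V : normedModType R[i])
  (L : set V) : Prop := submod_closed (mem L) /\ closed L.

Section Projection.
Context {R : realType} {H : hilbertType R}.
Implicit Types K N L : set H.

Definition ominus K N : set H :=
  [set x | K x /\ forall y, N y -> '[x, y] = 0].

(* The orthogonal projection onto L (unique, and total when L is a closed
   subspace). *)
Definition oproj L (x : H) : H :=
  get [set y | L y /\ forall z, L z -> '[x - y, z] = 0].

End Projection.

Section Relations.
Context {R : realType} {H : hilbertType R}.
Implicit Types (A B S : set (H * H)) (K L : set H).

Definition rdom A : set H := [set p.1 | p in A].
Definition rran A : set H := [set p.2 | p in A].
Definition rmul A : set H := [set f' | A (0, f')].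
Definition rinv A : set (H * H) := [set p | A (p.2, p.1)].
Definition ropp A : set (H * H) := [set p | A (p.1, - p.2)].
Definition rshift A (c : R[i]) : set (H * H) :=
  [set (p.1, p.2 + c *: p.1) | p in A].
Definition rcomp B A : set (H * H) :=
  [set p | exists g, A (p.1, g) /\ B (g, p.2)].
Definition rrestr A L : set (H * H) := [set p | A p /\ L p.1].

(* The value at f of the operator whose graph is A; meaningful only when A is
   single-valued and f belongs to rdom A. *)
Definition rapp A (f : H) : H := get [set f' | A (f, f')].

(* A relation in a closed subspace K, which is a Hilbert space for the inner
   product of H, is a subset of H * H contained in K `*` K.  The notions below
   are relative to K; a relation in H itself is the case K = setT. *)
Definition linear_relation K A : Prop :=
  closed_subspace A /\ A `<=` K `*` K.

Definition radjoint K A : set (H * H) :=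
  [set q | [/\ K q.1, K q.2 & forall p, A p -> '[p.2, q.1] = '[p.1, q.2]]].

(* In R[i], 0 <= z says that z is real and nonnegative. *)
Definition nonneg_selfadjoint K A : Prop :=
  [/\ linear_relation K A, A = radjoint K A &
      forall p, A p -> 0 <= '[p.2, p.1]].

(* The graph of the operator part A_o, an operator in K (-) mul A. *)
Definition opart K A : set (H * H) :=
  A `&` (ominus K (rmul A) `*` ominus K (rmul A)).

(* (A - l)^-1 = (A_o - l)^-1 P with P the projection onto K (-) mul A, for l in
   the resolvent set of A_o. *)
Definition resolvent K A (l : R[i]) (f : H) : H :=
  rapp (rinv (rshift (opart K A) (- l))) (oproj (ominus K (rmul A)) f).

(* The nonnegative selfadjoint square root of a nonnegative selfadjoint
   operator in K, as a graph: S is automatically single-valued, since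
   mul S is contained in mul (S o S). *)
Definition rsqrt K B : set (H * H) :=
  get [set S | nonneg_selfadjoint K S /\ rcomp S S = B].

Definition form_root K A : set (H * H) :=
  rsqrt (ominus K (rmul A)) (opart K A).

Definition form_dom K A : set H := rdom (form_root K A).

Definition form K A (f : H) : R[i] := `|rapp (form_root K A) f| ^+ 2.

Definition form_le K A1 A2 : Prop :=
  form_dom K A2 `<=` form_dom K A1 /\
  forall f, form_dom K A2 f -> form K A1 f <= form K A2 f.

Definition shorted_set A L : set (set (H * H)) :=
  [set B | [/\ nonneg_selfadjoint setT B, form_le setT B A & rran B `<=` L]].

(* A_L, the maximal element of shorted_set A L for the form order (it exists and
   is unique when A is nonnegative selfadjoint and L is a closed subspace). *)
Definition shorted A L : set (H * H) :=
  get [set B | shorted_set A L B /\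
    forall C, shorted_set A L C -> form_le setT B C -> C = B].

Definition compressed_resolvent A L (l : R[i]) : set (H * H) :=
  [set p | L p.1 /\ p.2 = oproj L (resolvent setT A l p.1)].

(* M_{A,L}(l), meaningful for l in the resolvent set of A. *)
Definition Mfun A L (l : R[i]) : set (H * H) :=
  rshift (ropp (rinv (compressed_resolvent A L l))) (- l).

(* B0 is the strong resolvent limit along F of the nonnegative selfadjoint
   relations B x in K. *)
Definition is_sRlim K (T : Type) (F : set_system T) (B : T -> set (H * H))
    (B0 : set (H * H)) : Prop :=
  [/\ \forall x \near F, nonneg_selfadjoint K (B x),
      nonneg_selfadjoint K B0 &
      forall f, K f ->
        resolvent K (B x) (- 1) f @[x --> F] --> resolvent K B0 (- 1) f].

End Relations.

(* Main.v *)
(* Let R = (A + I)^-1, so that A = {(R u, u - R u)} and A^-1 = {(u - R u, R u)}.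
   The form order A1 <= A2 is the operator order of the bounded operators
   X_i = I - R_i, since A[f] + |f|^2 is the supremum over u of
   2 Re (u, f) - (R u, u).  Hence A_L corresponds to the Krein short of X to L,
   i.e. the largest nonnegative operator below X with range in L, and the first
   claim holds because the shorts of X and I - X are below X and I - X.

   For s > 0, with P the projection onto L,
     -M_{A,L}(-s) = N_s = {(P f, P f') : (f, f') in A, (I - P) f' = - s (I - P) f},
   so (N_s + I)^-1 g = P f where g = f' + P f + s (I - P) f.  These operators are
   monotone in s and bounded, hence converge strongly as s tends to 0, and the
   minimum property of f shows that the limit is the compression of
   (A_L + I)^-1.  The limit at -oo follows from N_s(A) = N_{1/s}(A^-1)^-1. *)
Require Import Defs.
From mathcomp Require Import all_boot all_order all_algebra.
From mathcomp Require Import complex.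
From mathcomp Require Import all_classical all_reals topology normedtype.
From mathcomp Require Import ring lra.

Set Implicit Arguments.
Unset Strict Implicit.
Unset Printing Implicit Defensive.

Import Order.TTheory GRing.Theory Num.Theory.
Import numFieldNormedType.Exports.

Local Open Scope classical_set_scope.
Local Open Scope ring_scope.
Local Open Scope complex_scope.

(** The root inside [form] and the relation [shorted] are picked by [get], so each becomes usable
    only once existence is proved. For the root this takes an iteration for bounded operators,
    transported to relations. Any root then satisfies the variational formula, which expresses the
    form through the pairs of the relation, so the order does not depend on the root picked. For
    [shorted], a greatest element is exhibited, and antisymmetry of the order makes it the only
    maximal one.

    The operators [R] and [X] appear mostly as pairs: [p] in the relation stands for
    [u = p.1 + p.2], with [R u = p.1] and [X u = p.2], and an operator inequality compares pairs
    with equal sums. Selfadjointness serves to provide, for each sum, exactly one pair.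

    Strong convergence as [s] tends to 0 rests on one scalar for each [g]: the increment of
    [(P f, g)] dominates the squared increment of [P f], so the supremum of a bounded set of reals
    settles it. *)

(* The real part of the inner product: vector identities reduce through ip_inj
   and ipE to real arithmetic, which ring and lra settle. *)
Definition ip (R : realType) (H : hilbertType R) (x y : H) : R := complex.Re '[x, y].

Notation sq x := (ip x x).

(** * The real inner product *)

Section InnerProduct.
Context {R : realType} {H : hilbertType R}.
Implicit Types (x y z : H) (r : R).

Lemma ipDl x y z : ip (x + y) z = ip x z + ip y z.
Proof. by rewrite /ip linearDl raddfD. Qed.
Lemma ipDr x y z : ip z (x + y) = ip z x + ip z y.
Proof. by rewrite /ip linearDr raddfD. Qed.
Lemma ipNl x z : ip (- x) z = - ip x z.
Proof. by rewrite /ip linearNl raddfN. Qed.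
Lemma ipNr x z : ip z (- x) = - ip z x.
Proof. by rewrite /ip linearNr raddfN. Qed.
Lemma ip0l z : ip 0 z = 0.
Proof. by rewrite /ip linear0l. Qed.
Lemma ip0r z : ip z 0 = 0.
Proof. by rewrite /ip linear0r. Qed.
Lemma inner_sym x y : '[x, y] = conjc '[y, x].
Proof. by rewrite (hermC (eps := false)) expr0 mul1r. Qed.
Lemma ipC x y : ip x y = ip y x.
Proof. by rewrite /ip inner_sym; case: '[y, x]. Qed.
Lemma innerDl x y z : '[x + y, z] = '[x, z] + '[y, z].
Proof. by rewrite linearDl. Qed.
Lemma innerBl x y z : '[x - y, z] = '[x, z] - '[y, z].
Proof. by rewrite linearBl. Qed.
Lemma innerZl (c : R[i]) x z : '[c *: x, z] = c * '[x, z].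
Proof. by rewrite linearZl_LR. Qed.
Lemma ipZl r x z : ip (r%:C *: x) z = r * ip x z.
Proof. by rewrite /ip innerZl; case: '[x, z] => a b /=; rewrite mul0r subr0. Qed.
Lemma ipZr r x z : ip z (r%:C *: x) = r * ip z x.
Proof. by rewrite ipC ipZl ipC. Qed.
Lemma ipIm x z : ip ('i *: x) z = - complex.Im '[x, z].
Proof. by rewrite /ip innerZl; case: '[x, z] => a b /=; rewrite mul0r mul1r sub0r. Qed.
Lemma innerE x z : '[x, z] = ip x z +i* (- ip ('i *: x) z).
Proof. by rewrite ipIm opprK /ip; case: '[x, z]. Qed.
Lemma ipi x z : ip ('i *: x) ('i *: z) = ip x z.
Proof.
by rewrite /ip innerZl (inner_sym x) innerZl (inner_sym x z); case: '[z, x] => a b /=; ring.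
Qed.

Lemma ipiN x z : ip ('i *: x) z = - ip x ('i *: z).
Proof.
rewrite -(ipi x) scalerA (_ : 'i * 'i = -1); last by rewrite -expr2 sqr_i.
by rewrite scaleN1r ipNr opprK.
Qed.

Lemma ip_norm x : `|x| ^+ 2 = (sq x)%:C.
Proof.
rewrite -inner_norm innerE; congr (_ +i* _).
by rewrite ipiN opprK; have := ipiN x x; rewrite (ipC x ('i *: x)); lra.
Qed.

Lemma sq_ge0 x : 0 <= sq x.
Proof. by rewrite -ler0c -ip_norm exprn_ge0. Qed.

Lemma sq_eq0 x : sq x = 0 -> x = 0.
Proof.
move=> x0; apply/eqP; rewrite -normr_eq0 -sqrf_eq0 ip_norm x0.
by rewrite eqxx.
Qed.

Lemma ip_inj x y : (forall z, ip x z = ip y z) -> x = y.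
Proof.
move=> xy; apply/eqP; rewrite -subr_eq0; apply/eqP/sq_eq0.
by rewrite ipDl ipNl !xy subrr.
Qed.

Lemma ip_le x y : ip x y *+ 2 <= sq x + sq y.
Proof. by have := sq_ge0 (x - y); rewrite !(ipDl, ipDr, ipNl, ipNr) (ipC y x); lra. Qed.

Lemma ip_sqr_le x y : ip x y ^+ 2 <= sq x * sq y.
Proof.
have := sq_ge0 ((sq y)%:C *: x - (ip x y)%:C *: y).
have := sq_ge0 y; rewrite le0r => /orP[/eqP y0|y0].
  by rewrite (sq_eq0 y0) !ip0r expr0n mulr0.
rewrite !(ipDl, ipDr, ipNl, ipNr, ipZl, ipZr) (ipC y x) => h.
by rewrite -(ler_pM2l y0); nra.
Qed.

Lemma sqD_le x y : sq (x + y) <= sq x *+ 2 + sq y *+ 2.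
Proof. by rewrite !(ipDl, ipDr) (ipC y x); have := ip_le x y; lra. Qed.

Lemma innerP x y z w : (forall c : R[i], ip (c *: x) y = ip (c *: z) w) <-> '[x, y] = '[z, w].
Proof.
split=> [h|h c]; last by rewrite /ip !innerZl h.
by rewrite !innerE -[x in LHS]scale1r -[z in RHS]scale1r !scalerA !h.
Qed.

End InnerProduct.

Definition ipE (R : realType) (H : hilbertType R) :=
  (@ipDl R H, @ipDr R H, @ipNl R H, @ipNr R H, @ipZl R H, @ipZr R H,
   @ip0l R H, @ip0r R H).

(** * Completeness and Riesz representation *)

Section Completeness.
Context {R : realType} {H : hilbertType R}.
Implicit Types (x y z : H).

Lemma norm_lt x (e : R) : 0 < e -> (`|x| < e%:C) = (sq x < e ^+ 2).
Proof.
move=> e0; rewrite -ltcR -ip_norm rmorphXn /= ltr_pXn2r ?nnegrE //.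
by rewrite ler0c ltW.
Qed.

Lemma gt0_complexE (e : R[i]) : 0 < e -> exists2 r : R, 0 < r & e = r%:C.
Proof. by case: e => a b; rewrite ltcE /= => /andP[/eqP-> a0]; exists a. Qed.

Lemma nearP_sq (T : Type) (F : set_system T) (FF : Filter F) (u : T -> H) (l : H) :
  (forall e : R, 0 < e -> \forall t \near F, sq (u t - l) < e) -> u @ F --> l.
Proof.
move=> h; apply/cvgrPdist_lt => e /gt0_complexE[r r0 ->].
have := h _ (exprn_gt0 2 r0); apply: filterS => t.
by rewrite distrC norm_lt.
Qed.

(** Completeness is used only here. Every limit point below is caught as the point to which nested
    sets of approximate solutions shrink. *)
Lemma cantor_intersection (E : R -> set H) :
  (forall d, 0 < d -> E d !=set0) ->
  (forall d d', 0 < d -> d <= d' -> E d `<=` E d') ->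
  (forall e : R, 0 < e -> exists2 d, 0 < d &
    forall x y, E d x -> E d y -> sq (x - y) < e) ->
  exists l, forall e : R, 0 < e -> exists2 d, 0 < d & forall x, E d x -> sq (x - l) < e.
Proof.
move=> E0 Ele Ediam.
pose F := filter_from [set d : R | 0 < d] E.
have FF : ProperFilter F.
  apply: filter_from_proper; last by move=> d /E0.
  apply: filter_from_filter; first by exists 1 => /=.
  move=> i j /= i0 j0; exists (Num.min i j); first by rewrite /= lt_min i0.
  move=> x Ex; have m0 : 0 < Num.min i j by rewrite lt_min i0.
  by split; apply: Ele Ex => //; rewrite ge_min lexx ?orbT.
have cF : cauchy F.
  apply/cauchy_exP => e /gt0_complexE[r r0 ->].
  have [d d0 dE] := Ediam _ (exprn_gt0 2 r0).
  have [x Ex] := E0 _ d0; exists x; exists d => // y Ey.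
  by rewrite -ball_normE /= norm_lt // dE.
have /fcvgrPdist_lt Fl := @cauchy_cvg _ F FF cF.
exists (lim F) => e e0.
have s0 : 0 < Num.sqrt e by rewrite sqrtr_gt0.
have [|d d0 dE] := Fl (Num.sqrt e)%:C; first by rewrite ltcR.
exists d => // x /dE; rewrite distrC norm_lt // sqr_sqrtr //; exact: ltW.
Qed.

End Completeness.

Section Projections.
Context {R : realType} {H : hilbertType R}.
Implicit Types (x y z : H) (L : set H).

(** [G] is the graph of a real functional [l] on a subspace that need not be closed, and the bound
    says that its squared norm is at most [M]. The vector maximises [2 l(x) - |x|^2] over the
    closure of the domain; almost maximal vectors are close to each other by the parallelogram
    law. *)
Lemma riesz (G : set (H * R)) (M : R) :
  G (0, 0) ->
  (forall p q, G p -> G q -> G (p.1 + q.1, p.2 + q.2)) ->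
  (forall r p, G p -> G (r%:C *: p.1, r * p.2)) ->
  (forall p, G p -> p.2 *+ 2 - sq p.1 <= M) ->
  exists y, [/\ forall e : R, 0 < e -> exists2 p, G p & sq (p.1 - y) < e,
    forall p, G p -> p.2 = ip p.1 y & sq y <= M].
Proof.
move=> G0 GD GZ GM.
pose J (p : H * R) := p.2 *+ 2 - sq p.1.
pose s := sup [set J p | p in G].
have hs : has_sup [set J p | p in G].
  by split; [exists (J (0, 0)), (0, 0)|exists M => _ [p /GM pM <-]].
have Js p : G p -> J p <= s by move=> Gp; apply: sup_upper_bound => //; exists p.
have sM : s <= M by apply: ge_sup; [exact: hs.1|move=> _ [p /GM pM <-]].
pose E d : set H := [set p.1 | p in [set p | G p /\ s - d < J p]].
have [|||y yE] := @cantor_intersection _ _ E.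
- move=> d d0; have [_ [p Gp <-] pd] := sup_adherent d0 hs.
  by exists p.1, p.
- move=> d d' d0 dd' _ [p [Gp pd] <-]; exists p => //; split => //.
  by apply: le_lt_trans pd; rewrite lerD2l lerN2.
(* At a midpoint, [J] exceeds the mean of its two values by a quarter of the squared distance. *)
- move=> e e0; exists (e / 4); first by rewrite divr_gt0.
  move=> _ _ [p [Gp pd] <-] [q [Gq qd] <-].
  have := Js _ (GZ (2^-1) _ (GD _ _ Gp Gq)).
  by move: pd qd; rewrite /J /= !ipE (ipC q.1 p.1); lra.
have key e : 0 < e -> exists p, [/\ G p, sq (p.1 - y) < e & s - e < J p].
  move=> e0; have [d d0 dE] := yE _ e0.
  have m0 : 0 < Num.min d e by rewrite lt_min d0.
  have [_ [p Gp <-] pd] := sup_adherent m0 hs.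
  exists p; split => //.
    apply: dE; exists p => //; split => //; apply: le_lt_trans pd.
    by rewrite lerD2l lerN2 ge_min lexx.
  by apply: le_lt_trans pd; rewrite lerD2l lerN2 ge_min lexx orbT.
have lin p : G p -> p.2 = ip p.1 y.
  move=> Gp; apply/eqP; rewrite -subr_eq0; apply/eqP.
  (* This [t] makes [t * c = t ^+ 2 * (1 + sq p.1)], so the bound obtained by perturbing a near
     maximiser along [p] leaves [t ^+ 2 <= 0]. *)
  set c := _ - _; pose t := c / (1 + sq p.1).
  have S0 := sq_ge0 p.1.
  have : t * c <= t ^+ 2 * sq p.1.
    apply/ler_addgt0Pr => e e0; have [q [Gq qe qJ]] := key _ e0.
    have := Js _ (GD _ _ Gq (GZ t _ Gp)).
    have := ip_le (q.1 - y) (t%:C *: p.1).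
    move: qe qJ; rewrite /J /c /= !ipE (ipC p.1 q.1) (ipC y q.1) (ipC y p.1).
    by lra.
  have -> : c = t * (1 + sq p.1) by rewrite divfK //; lra.
  have : 0 <= t ^+ 2 by exact: sqr_ge0.
  by move=> t2 h; have -> : t = 0; [apply/eqP; rewrite -sqrf_eq0; nra|rewrite mul0r].
exists y; split => //; first by move=> e /key[p [Gp pe _]]; exists p.
apply/ler_addgt0Pr => e e0; have [q [Gq qe _]] := key _ e0.
have := Js _ Gq; move: qe; rewrite /J (lin _ Gq) !ipE (ipC y).
by lra.
Qed.

Lemma closed_sq L x : closed L ->
  (forall e : R, 0 < e -> exists2 y, L y & sq (y - x) < e) -> L x.
Proof.
move=> cL h; apply: cL => U /nbhs_ballP[e /gt0_complexE[r r0 ->] eU].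
have [y Ly yx] := h _ (exprn_gt0 2 r0); exists y; split => //; apply: eU.
by rewrite -ball_normE /= distrC norm_lt.
Qed.

End Projections.

(** * Orthogonal projections *)

Section Subspaces.
Context {R : realType} {H : hilbertType R}.
Implicit Types (x y z : H) (L : set H).

Section OneSubspace.
Context (L : set H) (hL : closed_subspace L).

Lemma subspace0 : L 0.
Proof. by case: hL => [[]]; rewrite inE. Qed.
Lemma subspace_comb c x y : L x -> L y -> L (c *: x + y).
Proof.
by case: hL => [[_ h] _ Lx Ly]; have := h c x y; rewrite !inE; apply.
Qed.
Lemma subspaceZ c x : L x -> L (c *: x).
Proof. by move=> Lx; rewrite -[_ *: _]addr0; apply: subspace_comb => //; exact: subspace0. Qed.
Lemma subspaceD x y : L x -> L y -> L (x + y).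
Proof. by move=> Lx Ly; rewrite -[x]scale1r; exact: subspace_comb. Qed.
Lemma subspaceN x : L x -> L (- x).
Proof. by rewrite -scaleN1r; exact: subspaceZ. Qed.
Lemma subspaceB x y : L x -> L y -> L (x - y).
Proof. by move=> Lx Ly; apply: subspaceD => //; exact: subspaceN. Qed.

Lemma orth_complex x : (forall z, L z -> ip x z = 0) -> forall z, L z -> '[x, z] = 0.
Proof.
move=> h z Lz; rewrite innerE ipiN !h ?oppr0 //.
exact: subspaceZ.
Qed.

Lemma oproj_spec x : L (oproj L x) /\ forall z, L z -> '[x - oproj L x, z] = 0.
Proof.
suff [y yP] : exists y, L y /\ forall z, L z -> '[x - y, z] = 0.
  exact: (@getPex _ [set y | L y /\ forall z, L z -> '[x - y, z] = 0] (ex_intro _ y yP)).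
have [||||y [yL yx _]] := @riesz _ _ [set p | L p.1 /\ p.2 = ip p.1 x] (sq x).
- by split; [exact: subspace0|rewrite /= ip0l].
- by move=> p q [pL px] [qL qx]; split; [exact: subspaceD|rewrite /= px qx ipE].
- by move=> r p [pL px]; split; [exact: subspaceZ|rewrite /= px ipE].
- by move=> p [pL ->]; have := ip_le p.1 x; lra.
exists y; split.
  apply: (closed_sq hL.2).
  by move=> e /yL[p [pL _] pe]; exists p.1.
apply: orth_complex => z Lz; have := yx (z, ip z x).
by rewrite /= !ipE !(ipC _ z) => ->; [rewrite subrr|split].
Qed.

Lemma oprojL x : L (oproj L x). Proof. exact: (oproj_spec x).1. Qed.

Lemma oprojE x z : L z -> ip (oproj L x) z = ip x z.
Proof.
move=> Lz; have /(congr1 (@complex.Re R)) := (oproj_spec x).2 z Lz.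
by rewrite -[LHS]/(ip _ _) !ipE /=; lra.
Qed.

Lemma oproj_uniq x y : L y -> (forall z, L z -> ip x z = ip y z) -> oproj L x = y.
Proof.
move=> Ly h; apply/eqP; rewrite -subr_eq0; apply/eqP/sq_eq0.
have Lxy : L (oproj L x - y) by apply: subspaceB => //; exact: oprojL.
by rewrite ipDl ipNl oprojE // h // subrr.
Qed.

Lemma oproj_id x : L x -> oproj L x = x.
Proof. by move=> Lx; apply: oproj_uniq. Qed.

Lemma oproj_comb c x y : oproj L (c *: x + y) = c *: oproj L x + oproj L y.
Proof.
apply: oproj_uniq => [|z Lz]; first by apply: subspace_comb; exact: oprojL.
have e w u : L u -> '[oproj L w, u] = '[w, u].
  by move=> Lu; apply/esym/eqP; rewrite -subr_eq0 -innerBl (oproj_spec w).2.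
by rewrite /ip !innerDl !innerZl !e.
Qed.

Lemma oprojD x y : oproj L (x + y) = oproj L x + oproj L y.
Proof. by rewrite -[x]scale1r oproj_comb !scale1r. Qed.

Lemma oproj0 : oproj L 0 = 0.
Proof. by apply: oproj_id; exact: subspace0. Qed.

Lemma oprojZ c x : oproj L (c *: x) = c *: oproj L x.
Proof. by rewrite -[c *: x]addr0 oproj_comb oproj0 addr0. Qed.

Lemma oprojN x : oproj L (- x) = - oproj L x.
Proof. by rewrite -scaleN1r oprojZ scaleN1r. Qed.

Lemma oproj_sym x y : ip (oproj L x) y = ip x (oproj L y).
Proof.
by rewrite -(oprojE x) ?(ipC _ y) -?(oprojE y) // ?(ipC (oproj L y)) //; exact: oprojL.
Qed.

Lemma oproj_idem x y : ip (oproj L x) (oproj L y) = ip (oproj L x) y.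
Proof. by rewrite -oproj_sym oproj_id //; exact: oprojL. Qed.

Lemma sq_oproj x : sq x = sq (oproj L x) + sq (x - oproj L x).
Proof. by rewrite !ipE (ipC x) !oproj_idem; lra. Qed.

End OneSubspace.

Lemma closed_subspaceT : closed_subspace [set: H].
Proof. by split; [split => [|? ? ? ? ?]; rewrite inE|exact: closedT]. Qed.

Lemma closed_subspace_ominus K N : closed_subspace K ->
  closed_subspace (ominus K N : set H).
Proof.
move=> hK; split.
  split => [|c x y]; rewrite !inE.
    by split; [exact: subspace0|move=> y _; rewrite linear0l].
  move=> [Kx xN] [Ky yN]; split; first exact: subspace_comb.
  by move=> z Nz; rewrite innerDl innerZl xN // yN // mulr0 addr0.
move=> x xc.
have near (e : R) : 0 < e -> exists2 y, ominus K N y & sq (y - x) < e.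
  move=> e0; have s0 : 0 < Num.sqrt e by rewrite sqrtr_gt0.
  have [y [Ny xy]] := xc _ (nbhsx_ballx x (Num.sqrt e)%:C (etrans (ltcR _ _) s0)).
  exists y => //; move: xy; rewrite -ball_normE /= distrC norm_lt // sqr_sqrtr //.
  exact: ltW.
split; first by apply: (closed_sq hK.2) => e /near[y [Ky _] ye]; exists y.
(* [N] is an arbitrary set, so the scalar multiplies [x]; [c = 'i] yields the imaginary part. *)
have orth c z : N z -> ip (c *: x) z = 0.
  move=> Nz; apply/eqP; rewrite -sqrf_eq0; apply/eqP/le_anti; rewrite sqr_ge0 andbT.
  apply/ler_addgt0Pr => e e0; rewrite add0r.
  have d0 : 0 < e / (1 + sq ((conjc c) *: z)).
    by rewrite divr_gt0 // ltr_pwDl // sq_ge0.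
  have cz w : ip (c *: w) z = ip w (conjc c *: z).
    by rewrite /ip innerZl (inner_sym w (_ *: z)) innerZl rmorphM /= conjcK -inner_sym.
  have [y [Ky yN] ye] := near _ d0.
  have -> : ip (c *: x) z = ip (x - y) (conjc c *: z).
    by rewrite -cz /ip !innerZl innerBl yN // subr0.
  apply: le_trans (ip_sqr_le _ _) _.
  have := ye; rewrite ltr_pdivlMr; last by rewrite ltr_pwDl // sq_ge0.
  have -> : sq (x - y) = sq (y - x) by rewrite !ipE; lra.
  by have := sq_ge0 (y - x); lra.
move=> z Nz; rewrite innerE (orth 'i) // oppr0.
by have := orth 1 z Nz; rewrite scale1r => ->.
Qed.

End Subspaces.

(** * Nonnegative selfadjoint relations *)

Section Selfadjoint.
Context {R : realType} {H : hilbertType R}.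
Implicit Types (x y z : H) (K L : set H) (A B : set (H * H)).

(** Passage to the limit in linear identities: the defect is a pairing with arbitrarily small
    errors, hence zero by Cauchy-Schwarz. *)
Lemma ip_vanishing (a b : H) (c : R) :
  (forall e : R, 0 < e -> exists x y, [/\ sq x < e, sq y < e & c = ip a x + ip b y]) ->
  c = 0.
Proof.
move=> h; apply/eqP; rewrite -sqrf_eq0; apply/eqP/le_anti; rewrite sqr_ge0 andbT.
apply/ler_addgt0Pr => e e0; rewrite add0r.
have [sa sb] := (sq_ge0 a, sq_ge0 b).
have S0 : 0 < 1 + sq a + sq b by lra.
have [|x [y [xe ye ->]]] := h (e / (1 + sq a + sq b) / 4); first by rewrite !divr_gt0.
move: xe ye; rewrite !ltr_pdivlMr // => xe ye.
have := ip_sqr_le a x; have := ip_sqr_le b y.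
have [sx sy] := (sq_ge0 x, sq_ge0 y).
have := mulr_ge0 sx sb; have := mulr_ge0 sy sa.
by have : 0 <= (ip a x - ip b y) ^+ 2 := sqr_ge0 _; rewrite !expr2; lra.
Qed.

Section Elim.
Context K A (hA : nonneg_selfadjoint K A).

Lemma nsa0 : A (0, 0).
Proof. by have [[[[h _] _] _] _ _] := hA; rewrite inE in h. Qed.

Lemma nsa_comb c p q : A p -> A q -> A (c *: p.1 + q.1, c *: p.2 + q.2).
Proof.
have [[[[_ h] _] _] _ _] := hA => Ap Aq.
by have := h c p q; rewrite !inE; apply.
Qed.

Lemma nsaZ c p : A p -> A (c *: p.1, c *: p.2).
Proof. by move=> Ap; have := nsa_comb c Ap nsa0; rewrite /= !addr0. Qed.

Lemma nsaD p q : A p -> A q -> A (p.1 + q.1, p.2 + q.2).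
Proof. by move=> Ap Aq; have := nsa_comb 1 Ap Aq; rewrite !scale1r. Qed.

Lemma nsaB p q : A p -> A q -> A (p.1 - q.1, p.2 - q.2).
Proof.
move=> Ap Aq; have := nsa_comb (-1) Aq Ap.
by rewrite !scaleN1r ![- _ + _]addrC.
Qed.

Lemma nsa_dom p : A p -> K p.1.
Proof. by have [[_ h] _ _] := hA => /h[]. Qed.

Lemma nsa_ran p : A p -> K p.2.
Proof. by have [[_ h] _ _] := hA => /h[]. Qed.

Lemma nsa_inner p q : A p -> A q -> '[p.2, q.1] = '[p.1, q.2].
Proof. by have [_ AE _] := hA => Ap; rewrite {1}AE => -[_ _]; exact. Qed.

Lemma nsa_sym p q : A p -> A q -> ip p.2 q.1 = ip p.1 q.2.
Proof. by move=> Ap Aq; rewrite /ip (nsa_inner Ap Aq). Qed.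

Lemma nsa_ge0 p : A p -> 0 <= ip p.2 p.1.
Proof.
have [_ _ h] := hA => /h; rewrite /ip lecE => /andP[_].
by [].
Qed.

(** Real parts suffice because [A] is complex linear: multiplying [p] by all scalars recovers the
    imaginary part. *)
Lemma nsa_adj q : K q.1 -> K q.2 -> (forall p, A p -> ip p.2 q.1 = ip p.1 q.2) -> A q.
Proof.
have [_ AE _] := hA => K1 K2 h; rewrite AE; split => // p Ap.
apply/innerP => c; have := h _ (nsaZ c Ap); exact.
Qed.

End Elim.

(** Closedness follows since limits of pairs of [A] still satisfy the adjoint identities. Symmetry
    makes ['[p.2, p.1]] its own conjugate, so nonnegativity of the real part is enough. *)
Lemma nsa_intro_adj K A : closed_subspace K -> A (0, 0) ->
  (forall c p q, A p -> A q -> A (c *: p.1 + q.1, c *: p.2 + q.2)) ->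
  (forall p, A p -> K p.1 /\ K p.2) ->
  (forall p q, A p -> A q -> ip p.2 q.1 = ip p.1 q.2) ->
  (forall p, A p -> 0 <= ip p.2 p.1) ->
  (forall q, K q.1 -> K q.2 -> (forall p, A p -> ip p.2 q.1 = ip p.1 q.2) -> A q) ->
  nonneg_selfadjoint K A.
Proof.
move=> hK A0 AP AK Asym Age0 Aadj.
have AZ c p : A p -> A (c *: p.1, c *: p.2).
  by move=> Ap; have := AP c _ _ Ap A0; rewrite /= !addr0.
have Ainner p q : A p -> A q -> '[p.2, q.1] = '[p.1, q.2].
  move=> Ap Aq; apply/innerP => c; exact: (Asym (c *: p.1, c *: p.2) q (AZ c p Ap) Aq).
split.
- split; last by move=> p /AK.
  split; first by split => [|c p q]; rewrite !inE //; exact: AP.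
  move=> q qc.
  have near (e : R) : 0 < e -> exists2 p, A p & sq (p.1 - q.1) < e /\ sq (p.2 - q.2) < e.
    move=> e0; have s0 : 0 < Num.sqrt e by rewrite sqrtr_gt0.
    have s0C : 0 < (Num.sqrt e)%:C by rewrite ltcR.
    have [|p [Ap [/= p1 p2]]] := qc (ball q.1 (Num.sqrt e)%:C `*` ball q.2 (Num.sqrt e)%:C).
      by exists (ball q.1 (Num.sqrt e)%:C, ball q.2 (Num.sqrt e)%:C) => //; split;
        exact: nbhsx_ballx.
    exists p => //; move: p1 p2; rewrite -!ball_normE /=.
    by rewrite !(distrC q.1) !(distrC q.2) !norm_lt // sqr_sqrtr //; exact: ltW.
  apply: Aadj.
  + by apply: (closed_sq hK.2) => e /near[p /AK[p1 _] [pe _]]; exists p.1.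
  + by apply: (closed_sq hK.2) => e /near[p /AK[_ p2] [_ pe]]; exists p.2.
  + move=> p Ap; apply/eqP; rewrite -subr_eq0; apply/eqP.
    apply: (@ip_vanishing p.1 p.2) => e /near[r Ar [r1 r2]].
    exists (r.2 - q.2), (- (r.1 - q.1)); split => //; first by rewrite ipNl ipNr opprK.
    by have := Asym _ _ Ap Ar; rewrite !ipE; lra.
- apply/seteqP; split => q.
    by move=> Aq; have [] := AK _ Aq; split => // p Ap; exact: Ainner.
  by move=> [K1 K2 h]; apply: Aadj => // p Ap; rewrite /ip h.
- move=> p Ap; rewrite lecE -[complex.Re '[_, _]]/(ip _ _) Age0 // andbT /= eq_sym.
  have := Ainner _ _ Ap Ap; rewrite (inner_sym p.1).
  by case: '[p.2, p.1] => a b [] /= h; apply/eqP; lra.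
Qed.

(** Range criterion for selfadjointness. For [q] in the adjoint, take the pair [p] of [A] with the
    same sum: [p.1 - q.1] is orthogonal to [ran (A + I)], which is [K]. *)
Lemma nsa_intro_surj K A : closed_subspace K -> A (0, 0) ->
  (forall c p q, A p -> A q -> A (c *: p.1 + q.1, c *: p.2 + q.2)) ->
  (forall p, A p -> K p.1 /\ K p.2) ->
  (forall p q, A p -> A q -> ip p.2 q.1 = ip p.1 q.2) ->
  (forall p, A p -> 0 <= ip p.2 p.1) ->
  (forall g, K g -> exists2 p, A p & p.1 + p.2 = g) ->
  nonneg_selfadjoint K A.
Proof.
move=> hK A0 AP AK Asym Age0 Asurj; apply: nsa_intro_adj => // q K1 K2 h.
have [p Ap pq] := Asurj _ (subspaceD hK K1 K2).
suff e : p.1 = q.1.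
  have e2 : p.2 = q.2 by move: pq; rewrite e => /addrI.
  by rewrite (surjective_pairing q) -e -e2 -surjective_pairing.
have K3 : K (p.1 - q.1) by apply: subspaceB => //; have [] := AK _ Ap.
have [r Ar re] := Asurj _ K3.
apply/eqP; rewrite -subr_eq0; apply/eqP/sq_eq0; rewrite -[X in ip X _]re.
have := h _ Ar; have := Asym _ _ Ar Ap.
have : ip r.1 (p.1 + p.2) = ip r.1 (q.1 + q.2) by rewrite pq.
by rewrite !ipE; lra.
Qed.

Lemma sq_nsa K A p : nonneg_selfadjoint K A -> A p ->
  sq p.1 + sq p.2 <= sq (p.1 + p.2).
Proof. by move=> hA /(nsa_ge0 hA); rewrite !ipE (ipC p.1 p.2); lra. Qed.

(** The part [g - y] of [g] orthogonal to [ran (A + I)] gives the pair [(g - y, - (g - y))] of the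
    adjoint, and nonnegativity forces [g = y]; so the range is dense. By [sq_nsa] the first
    components of approximate solutions are Cauchy, and their limit solves the equation. *)
Lemma nsa_surj K A g : closed_subspace K -> nonneg_selfadjoint K A -> K g ->
  exists2 p, A p & p.1 + p.2 = g.
Proof.
move=> hK hA Kg.
have [||||y [yG yl _]] := @riesz _ _
    [set r | exists2 p, A p & r = (p.1 + p.2, ip (p.1 + p.2) g)] (sq g).
- by exists (0, 0); [exact: nsa0 hA|rewrite /= addr0 ip0l].
- move=> _ _ [p Ap ->] [q Aq ->]; exists (p.1 + q.1, p.2 + q.2); first exact: (nsaD hA).
  by congr (_, _) => /=; [exact: addrACA|rewrite !ipE; ring].
- move=> r _ [p Ap ->]; exists (r%:C *: p.1, r%:C *: p.2); first exact: (nsaZ hA).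
  by rewrite /= -scalerDr ipZl.
- by move=> _ [p Ap ->] /=; have := ip_le (p.1 + p.2) g; lra.
have yK : K y.
  apply: (closed_sq hK.2) => e /yG[_ [p Ap ->] /= pe]; exists (p.1 + p.2) => //.
  by apply: subspaceD => //; [exact: nsa_dom hA _ Ap|exact: nsa_ran hA _ Ap].
have gy : g = y.
  have : A (g - y, - (g - y)).
    apply: (nsa_adj hA); rewrite /=; first exact: subspaceB.
      by apply: subspaceN => //; exact: subspaceB.
    move=> p Ap; have := yl (p.1 + p.2, ip (p.1 + p.2) g) (ex_intro2 _ _ p Ap erefl).
    by rewrite /= !ipE; lra.
  move=> /(nsa_ge0 hA); rewrite /= ipNl => h.
  by apply/eqP; rewrite -subr_eq0; apply/eqP/sq_eq0/le_anti; rewrite sq_ge0 andbT; lra.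
pose E d : set H := [set p.1 | p in [set p | A p /\ sq (p.1 + p.2 - g) < d]].
have [|||f fE] := @cantor_intersection _ _ E.
- move=> d /yG[_ [p Ap ->] /= pe]; exists p.1, p => //; split => //.
  by rewrite gy.
- by move=> d d' d0 dd' _ [p [Ap pd] <-]; exists p => //; split => //; exact: lt_le_trans dd'.
- move=> e e0; exists (e / 4); first by rewrite divr_gt0.
  move=> _ _ [p [Ap pd] <-] [q [Aq qd] <-].
  have := sq_nsa hA (nsaB hA Ap Aq) => /=.
  have -> : p.1 - q.1 + (p.2 - q.2) = (p.1 + p.2 - g) + - (q.1 + q.2 - g).
    by apply: ip_inj => z; rewrite !ipE; ring.
  have := sqD_le (p.1 + p.2 - g) (- (q.1 + q.2 - g)).
  have := sq_ge0 (p.2 - q.2).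
  have -> : sq (- (q.1 + q.2 - g)) = sq (q.1 + q.2 - g) by rewrite ipNl ipNr opprK.
  lra.
have key (e : R) : 0 < e -> exists2 p, A p & sq (p.1 - f) < e /\ sq (p.1 + p.2 - g) < e.
  move=> e0; have [d d0 dE] := fE _ e0.
  have m0 : 0 < Num.min d e by rewrite lt_min d0.
  have [_ [p Ap ->]] := yG _ m0; rewrite -gy lt_min => /andP[p1 p2].
  by exists p => //; split => //; apply: dE; exists p.
exists (f, g - f); last by rewrite /= addrC subrK.
have Kf : K f.
  by apply: (closed_sq hK.2) => e /key[p Ap [pe _]]; exists p.1 => //; exact: nsa_dom hA _ Ap.
apply: (nsa_adj hA) => /=; first by [].
  exact: subspaceB.
move=> p Ap; apply/eqP; rewrite -subr_eq0; apply/eqP.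
apply: (@ip_vanishing p.1 (p.1 + p.2)) => e /key[r Ar [r1 r2]].
exists (r.1 + r.2 - g), (- (r.1 - f)); split => //; first by rewrite ipNl ipNr opprK.
by have := nsa_sym hA Ap Ar; rewrite !ipE; lra.
Qed.

End Selfadjoint.

(** * Resolvents, operator parts and weighted equations *)

Section Resolvents.
Context {R : realType} {H : hilbertType R}.
Implicit Types (x y z : H) (K L : set H) (A B : set (H * H)).

Lemma nsa_rinv K A : closed_subspace K ->
  nonneg_selfadjoint K A -> nonneg_selfadjoint K (rinv A).
Proof.
move=> hK hA; apply: nsa_intro_surj => //.
- exact: nsa0 hA.
- by move=> c p q Ap Aq; exact: (nsa_comb hA c Ap Aq).
- by move=> p Ap; split; [exact: nsa_ran hA _ Ap|exact: nsa_dom hA _ Ap].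
- by move=> p q Ap Aq; rewrite (nsa_sym hA Ap Aq).
- by move=> p Ap; rewrite ipC; exact: nsa_ge0 hA _ Ap.
- move=> g /(nsa_surj hK hA)[p Ap <-]; exists (p.2, p.1); last by rewrite addrC.
  by rewrite /rinv /= -surjective_pairing.
Qed.

Lemma nsa_uniq K A p q (s : R) : nonneg_selfadjoint K A -> A p -> A q -> 0 < s ->
  p.2 + s%:C *: p.1 = q.2 + s%:C *: q.1 -> p = q.
Proof.
move=> hA Ap Aq s0 pq; have Ad := nsaB hA Ap Aq; have := nsa_ge0 hA Ad.
have -> : (p.1 - q.1, p.2 - q.2).2 = - (s%:C *: (p.1 - q.1)).
  by rewrite /= scalerBr; apply/eqP; rewrite -subr_eq0 opprK addrACA -opprD pq subrr.
rewrite /= ipNl ipZl oppr_ge0 pmulr_rle0 // => d0.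
have e : p.1 = q.1.
  by apply/eqP; rewrite -subr_eq0; apply/eqP/sq_eq0/le_anti; rewrite sq_ge0 andbT.
move: pq; rewrite e => /addIr e2.
by rewrite (surjective_pairing p) e e2 -surjective_pairing.
Qed.

Lemma nsa_dom_ominus K A p : nonneg_selfadjoint K A -> A p -> ominus K (rmul A) p.1.
Proof.
move=> hA Ap; split; first exact: nsa_dom hA _ Ap.
by move=> m Am; have := nsa_inner hA Ap Am; rewrite linear0r => <-.
Qed.

(** [dom A] lies in [ominus K (rmul A)], so [(0, g)] satisfies the adjoint identities. *)
Lemma nsa_mul K A g : nonneg_selfadjoint K A -> closed_subspace K -> K g ->
  (forall z, ominus K (rmul A) z -> ip g z = 0) -> A (0, g).
Proof.
move=> hA hK Kg h; apply: (nsa_adj hA) => //=; first exact: subspace0.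
by move=> p /(nsa_dom_ominus hA)/h; rewrite ip0r ipC.
Qed.

Lemma nsa_proj_ran K A p : nonneg_selfadjoint K A -> closed_subspace K -> A p ->
  opart K A (p.1, oproj (ominus K (rmul A)) p.2).
Proof.
move=> hA hK Ap; have hO : closed_subspace (ominus K (rmul A)).
  exact: closed_subspace_ominus.
split; last by split; [exact: nsa_dom_ominus hA Ap|exact: oprojL].
have : A (0, p.2 - oproj (ominus K (rmul A)) p.2).
  apply: (nsa_mul hA) => // [|z Oz]; last by rewrite ipDl ipNl oprojE // subrr.
  apply: subspaceB => //; first exact: nsa_ran hA _ Ap.
  by have [] := oprojL hO p.2.
by move=> /(nsaB hA Ap); rewrite /= subr0 opprB addrC subrK.
Qed.

Lemma nsa_opart K A : closed_subspace K -> nonneg_selfadjoint K A ->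
  nonneg_selfadjoint (ominus K (rmul A)) (opart K A).
Proof.
move=> hK hA; have hO : closed_subspace (ominus K (rmul A)).
  exact: closed_subspace_ominus.
apply: nsa_intro_surj => //.
- by split; [exact: nsa0 hA|split; exact: subspace0].
- move=> c p q [Ap [p1 p2]] [Aq [q1 q2]]; split; first exact: (nsa_comb hA c Ap Aq).
  by split; exact: subspace_comb.
- by move=> p [_ []].
- by move=> p q [Ap _] [Aq _]; exact: nsa_sym hA _ _ Ap Aq.
- by move=> p [Ap _]; exact: nsa_ge0 hA _ Ap.
- move=> g Og; have [p Ap pg] := nsa_surj hK hA Og.1; exists p => //.
  have p1 := nsa_dom_ominus hA Ap; split => //; split => //.
  have -> : p.2 = g - p.1 by rewrite -pg addrAC subrr add0r.
  exact: subspaceB.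
Qed.

(** Projecting the second component off [mul A] gives a pair of the operator part with the same
    first component. Hence [resolvent], defined through the operator part, can be read off from any
    pair of [A]. *)
Lemma resolventE K A p (s : R) : closed_subspace K -> nonneg_selfadjoint K A ->
  0 < s -> A p -> resolvent K A (- s%:C) (p.2 + s%:C *: p.1) = p.1.
Proof.
move=> hK hA s0 Ap; have hO : closed_subspace (ominus K (rmul A)).
  exact: closed_subspace_ominus.
have Oq := nsa_proj_ran hA hK Ap; set q := (p.1, _) in Oq.
have fE : oproj (ominus K (rmul A)) (p.2 + s%:C *: p.1) = q.2 + s%:C *: q.1.
  by rewrite oprojD // oprojZ // [oproj _ p.1]oproj_id //; exact: Oq.2.1.
rewrite /resolvent fE /rapp; set S := [set f' | _].
have : S (get S) by apply: getPex; exists q.1, q; rewrite ?opprK.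
by move=> [r Or [<-]]; rewrite opprK => /(nsa_uniq (nsa_opart hK hA) Or Oq s0) ->.
Qed.

Lemma resolvent1E K A p : closed_subspace K -> nonneg_selfadjoint K A ->
  A p -> resolvent K A (- 1) (p.1 + p.2) = p.1.
Proof.
by move=> hK hA Ap; have := resolventE hK hA ltr01 Ap; rewrite scale1r addrC.
Qed.

(** With [P] the projection onto [L] and [C = a P + b (1 - P)], the congruent relation [C^-1 A C^-1]
    is again nonnegative selfadjoint. Adding the identity to it gives a surjective relation, and
    undoing the congruence solves [A f + C^2 f = g]; hence the squared weights. *)
Lemma weighted_surj A L (a b : R) g : nonneg_selfadjoint setT A ->
  closed_subspace L -> 0 < a -> 0 < b -> exists2 p, A p &
    p.2 + ((a ^+ 2)%:C *: oproj L p.1 + (b ^+ 2)%:C *: (p.1 - oproj L p.1)) = g.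
Proof.
move=> hA hL a0 b0.
pose C := fun (u v : R) x => u%:C *: oproj L x + v%:C *: (x - oproj L x).
have projC u v x : oproj L (C u v x) = u%:C *: oproj L x.
  rewrite /C oprojD // !(oprojZ hL) (oprojD hL) (oprojN hL) (oproj_id hL (oprojL hL _)).
  by rewrite subrr scaler0 addr0.
have CC : forall (u v r t : R) x, C u v (C r t x) = C (u * r) (v * t) x.
  by move=> u v r t x; rewrite {1}/C projC; apply: ip_inj => z; rewrite /C !ipE; ring.
have C1 x : C 1 1 x = x.
  by rewrite /C -scalerDr addrC subrK scale1r.
have CP u v c x y : C u v (c *: x + y) = c *: C u v x + C u v y.
  rewrite /C oproj_comb // opprD addrACA -scalerBr.
  move: (oproj L x) (x - _) (oproj L y) (y - _) => x1 x2 y1 y2.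
  by rewrite !scalerDr !scalerA ![c * _]mulrC addrACA.
have Csym u v x y : ip (C u v x) y = ip x (C u v y).
  by rewrite /C !ipE (oproj_sym hL x y); ring.
have C0 u v : C u v 0 = 0 by rewrite /C oproj0 // subr0 !scaler0 addr0.
have [an0 bn0] : a != 0 /\ b != 0 by rewrite !gt_eqF.
have Cab x : C a b (C a^-1 b^-1 x) = x by rewrite CC !mulfV // C1.
have Cba x : C a^-1 b^-1 (C a b x) = x by rewrite CC !mulVf // C1.
pose B := [set q | A (C a^-1 b^-1 q.1, C a b q.2)].
have hB : nonneg_selfadjoint setT B.
  apply: nsa_intro_adj => //; first exact: closed_subspaceT.
  - by rewrite /B /= !C0; exact: nsa0 hA.
  - by move=> c p q Bp Bq; rewrite /B /= !CP; exact: (nsa_comb hA c Bp Bq).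
  - by move=> p q Bp Bq; have /= := nsa_sym hA Bp Bq; rewrite -Csym Cba -Csym Cab => ->.
  - by move=> p Bp; have /= := nsa_ge0 hA Bp; rewrite -Csym Cba.
  move=> q _ _ h; apply: (nsa_adj hA) => //= p Ap.
  rewrite -!Csym; have /= -> := h (C a b p.1, C a^-1 b^-1 p.2) _ => //.
  by rewrite /B /= Cba Cab -surjective_pairing.
have [q Bq qE] := nsa_surj closed_subspaceT hB (I : setT (C a^-1 b^-1 g)).
exists (C a^-1 b^-1 q.1, C a b q.2) => //=.
rewrite -[_ + _ *: (_ - _)]/(C (a ^+ 2) (b ^+ 2) _) !expr2 -CC Cab.
rewrite -[RHS]Cab -qE.
by have := CP a b 1 q.1 q.2; rewrite !scale1r => ->; rewrite addrC.
Qed.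

End Resolvents.

(** * Square roots *)

Section SquareRoot.
Context {R : realType} {H : hilbertType R}.
Implicit Types (x y z u v w : H) (X Y Z W : H -> H).

Definition is_lin Z := forall (c : R[i]) x y, Z (c *: x + y) = c *: Z x + Z y.
Definition is_sym Z := forall x y, ip (Z x) y = ip x (Z y).

Lemma is_linD Z x y : is_lin Z -> Z (x + y) = Z x + Z y.
Proof. by move=> h; rewrite -[x in LHS]scale1r h scale1r. Qed.
Lemma is_lin0 Z : is_lin Z -> Z 0 = 0.
Proof. by move=> h; apply: (addrI (Z 0)); rewrite -is_linD // !addr0. Qed.
Lemma is_linZ Z c x : is_lin Z -> Z (c *: x) = c *: Z x.
Proof. by move=> h; rewrite -[c *: x]addr0 h is_lin0 // addr0. Qed.
Lemma is_linN Z x : is_lin Z -> Z (- x) = - Z x.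
Proof. by move=> h; rewrite -scaleN1r is_linZ // scaleN1r. Qed.
Lemma is_linB Z x y : is_lin Z -> Z (x - y) = Z x - Z y.
Proof. by move=> h; rewrite is_linD // is_linN. Qed.

Lemma ipZc (c : R[i]) x z : ip (c *: x) z = ip x (conjc c *: z).
Proof.
by rewrite /ip innerZl (inner_sym x (_ *: z)) innerZl rmorphM /= conjcK -inner_sym.
Qed.

Lemma is_sym_lin Z : is_sym Z -> (forall c x, Z (c *: x) = c *: Z x) -> is_lin Z.
Proof.
by move=> hZ Zc c x y; apply: ip_inj => z; rewrite hZ !ipDl -!hZ Zc.
Qed.

Definition tends (T : Type) (F : set_system T) (u : T -> H) (l : H) :=
  forall e : R, 0 < e -> \forall t \near F, sq (u t - l) < e.

Lemma tends_ip_eq (T : Type) (F : set_system T) (FF : ProperFilter F)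
  (u w : T -> H) (l m a b : H) : tends F u l -> tends F w m ->
  (\forall t \near F, ip (u t) a = ip (w t) b) -> ip l a = ip m b.
Proof.
move=> ul wm uw; apply/eqP; rewrite -subr_eq0; apply/eqP.
apply: (@ip_vanishing _ _ a b) => e e0.
have [t [[ut wt] uwt]] := filter_ex (filterI (filterI (ul _ e0) (wm _ e0)) uw).
exists (- (u t - l)), (w t - m); split => //; first by rewrite ipNl ipNr opprK.
by rewrite !(ipC a) !(ipC b) !ipE; lra.
Qed.

Lemma tends_ip_le (T : Type) (F : set_system T) (FF : ProperFilter F)
  (u : T -> H) (l a : H) (M : R) : tends F u l ->
  (forall e, 0 < e -> \forall t \near F, ip (u t) a <= M + e) -> ip l a <= M.
Proof.
move=> ul uM; rewrite leNgt; apply/negP => lM.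
pose c := (ip l a - M) / 2; have c0 : 0 < c by rewrite divr_gt0 // subr_gt0.
have S0 : 0 < 1 + sq a by have := sq_ge0 a; lra.
have e0 : 0 < c ^+ 2 / (1 + sq a) by rewrite divr_gt0 // exprn_gt0.
have [t [ut uMt]] := filter_ex (filterI (ul _ e0) (uM _ c0)).
move: ut; rewrite ltr_pdivlMr // => h.
have cl : c <= ip (l - u t) a by move: uMt; rewrite !ipE /c; lra.
have : c ^+ 2 <= ip (l - u t) a ^+ 2 by rewrite ler_pXn2r ?nnegrE //; lra.
have := ip_sqr_le (l - u t) a.
have -> : sq (l - u t) = sq (u t - l) by rewrite !ipE; lra.
have := sq_ge0 (u t - l); lra.
Qed.

Section Root.
Context (X : H -> H) (Xlin : is_lin X) (Xsym : is_sym X).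
Hypothesis Xcontr : forall u, sq (X u) <= sq u.

(* Polynomials in X with nonnegative coefficients of sum c. *)
Inductive cone : R -> (H -> H) -> Prop :=
| cone_id : cone 1 id
| cone_X c Y : cone c Y -> cone c (X \o Y)
| cone_D c d Y W : cone c Y -> cone d W -> cone (c + d) (fun u => Y u + W u)
| cone_Z r c Y : 0 <= r -> cone c Y -> cone (r * c) (fun u => r%:C *: Y u).

Lemma cone_ge0 c Y : cone c Y -> 0 <= c.
Proof.
by elim=> [|? ? _ ?|? ? ? ? _ ? _ ?|? ? ? ? _ ?] //; [exact: addr_ge0|exact: mulr_ge0].
Qed.

Lemma cone_lin c Y : cone c Y -> is_lin Y.
Proof.
elim=> [|{}c {}Y _ h|c1 c2 Y1 Y2 _ h _ k|r {}c {}Y _ _ h] a x y //=.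
- by rewrite h Xlin.
- by rewrite h k scalerDr addrACA.
- by rewrite h scalerDr !scalerA mulrC.
Qed.

Lemma cone_comm W c Y : is_lin W -> (forall u, W (X u) = X (W u)) -> cone c Y ->
  forall u, W (Y u) = Y (W u).
Proof.
move=> Wlin WX; elim=> [|{}c {}Y _ h|c1 c2 Y1 Y2 _ h _ k|r {}c {}Y _ _ h] u //=.
- by rewrite WX h.
- by rewrite is_linD // h k.
- by rewrite is_linZ // h.
Qed.

Lemma cone_comm2 c d Y W : cone c Y -> cone d W -> forall u, W (Y u) = Y (W u).
Proof.
move=> hY hW; apply: (cone_comm (cone_lin hW) _ hY) => u; apply/esym.
exact: (cone_comm Xlin _ hW).
Qed.

Lemma cone_sym c Y : cone c Y -> is_sym Y.
Proof.
move=> hY; elim: hY => [|{}c {}Y hY h|c1 c2 Y1 Y2 _ h _ k|r {}c {}Y _ _ h] x y //=.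
- by rewrite Xsym h -(cone_comm Xlin _ hY).
- by rewrite !ipE h k.
- by rewrite !ipE h.
Qed.

Lemma cone_bound c Y u : cone c Y -> sq (Y u) <= c ^+ 2 * sq u.
Proof.
move=> hY; elim: hY u => [|{}c {}Y hY h|c1 c2 Y1 Y2 hY1 h hY2 k|r {}c {}Y r0 _ h] u /=.
- by rewrite expr1n mul1r.
- exact: le_trans (Xcontr _) (h u).
- have c10 := cone_ge0 hY1; have c20 := cone_ge0 hY2.
  have [[s0 a0] b0] := (sq_ge0 u, sq_ge0 (Y1 u), sq_ge0 (Y2 u)).
  have := ip_sqr_le (Y1 u) (Y2 u); rewrite !ipE (ipC (Y2 u) (Y1 u)).
  have [] := (h u, k u); move: s0 a0 b0.
  move: (sq u) (sq (Y1 u)) (sq (Y2 u)) (ip (Y1 u) (Y2 u)) => s a b i s0 a0 b0 as_ bs iab.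
  have : i <= c1 * c2 * s.
    have cs0 : 0 <= c1 * c2 * s by rewrite !mulr_ge0.
    case: (leP i 0) => [i0|i0]; first exact: le_trans i0 cs0.
    rewrite -(@ler_pXn2r _ 2) ?nnegrE ?(ltW i0) //.
    apply: (le_trans iab); apply: le_trans (ler_pM a0 b0 as_ bs) _.
    by rewrite le_eqVlt; apply/orP; left; apply/eqP; ring.
  by lra.
- by have := ler_wpM2l (sqr_ge0 r) (h u); rewrite !ipE; lra.
Qed.

Lemma cone_comp c d Y W : cone c Y -> cone d W -> cone (c * d) (Y \o W).
Proof.
move=> hY hW; elim: hY => [|{}c {}Y hY h|c1 c2 Y1 Y2 _ h _ k|r {}c {}Y r0 _ h].
- by rewrite mul1r.
- exact: cone_X h.
- by rewrite mulrDl; exact: cone_D h k.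
- by rewrite -mulrA; exact: cone_Z h.
Qed.

(** Iteration for [Y = (X + Y^2) / 2], which is equivalent to [(1 - Y)^2 = 1 - X]. [root_sum] is the
    same iteration with 1 in place of [X], hence the sum of the coefficients. *)
Fixpoint root_seq n : H -> H :=
  if n is m.+1 then fun u => (2^-1)%:C *: (X u + root_seq m (root_seq m u))
  else fun=> 0.
Fixpoint root_sum n : R := if n is m.+1 then 2^-1 * (1 + root_sum m * root_sum m) else 0.

Lemma cone0 : cone 0 (fun=> 0).
Proof.
have := cone_Z (lexx 0) cone_id; rewrite mul0r.
by congr cone; apply/funext => u; rewrite scale0r.
Qed.

Lemma root_seq_cone n : cone (root_sum n) (root_seq n).
Proof.
elim: n => [|n h] /=; first exact: cone0.
apply: cone_Z; first by rewrite invr_ge0.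
apply: cone_D; first exact: (cone_X cone_id).
exact: (cone_comp h h).
Qed.

(** The next difference is half of [(Y' - Y) (Y' + Y)] for consecutive iterates [Y], [Y'], which
    commute; so nonnegative coefficients persist. Through [cone_bound], distances between iterates
    are then controlled by the bounded increasing scalars [root_sum]. *)
Lemma root_seq_step n : cone (root_sum n.+1 - root_sum n)
  (fun u => root_seq n.+1 u - root_seq n u).
Proof.
elim: n => [|n h].
  have half0 : 0 <= 2^-1 :> R by rewrite invr_ge0.
  have := cone_Z half0 (cone_X cone_id); congr cone; first by rewrite /=; ring.
  by apply/funext => u; rewrite /= addr0 subr0.
have half0 : 0 <= 2^-1 :> R by rewrite invr_ge0.
have := cone_Z half0 (cone_comp h (cone_D (root_seq_cone n.+1) (root_seq_cone n))).
congr cone.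
  have : root_sum n.+2 = 2^-1 * (1 + root_sum n.+1 * root_sum n.+1) by [].
  have : root_sum n.+1 = 2^-1 * (1 + root_sum n * root_sum n) by [].
  by move: (root_sum n.+2) (root_sum n.+1) (root_sum n) => a b d; lra.
apply/funext => u.
rewrite [root_seq n.+2]/=; set Y1 := root_seq n.+1; set Y0 := root_seq n.
have hY1 : cone _ Y1 := root_seq_cone n.+1; have hY0 : cone _ Y0 := root_seq_cone n.
rewrite /= !(is_linD _ _ (cone_lin hY1)) !(is_linD _ _ (cone_lin hY0)).
rewrite -(cone_comm2 hY1 hY0).
have {2}-> : Y1 u = (2^-1)%:C *: (X u + Y0 (Y0 u)) by [].
by apply: ip_inj => z; rewrite !ipE; ring.
Qed.

Lemma root_seq_diff n k : cone (root_sum (n + k) - root_sum n)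
  (fun u => root_seq (n + k) u - root_seq n u).
Proof.
elim: k => [|k h].
  by have := cone0; congr cone; [|apply/funext => u]; rewrite addn0 subrr.
have := cone_D (root_seq_step (n + k)) h; rewrite addnS; congr cone; first by ring.
by apply/funext => u; apply: ip_inj => z; rewrite !ipE; ring.
Qed.

Lemma root_sum_le n k : root_sum n <= root_sum (n + k).
Proof. by rewrite -subr_ge0; exact: cone_ge0 (root_seq_diff n k). Qed.

Lemma root_sum_le1 n : root_sum n <= 1.
Proof.
elim: n => [|n h] /=; first exact: ler01.
by have := cone_ge0 (root_seq_cone n); nra.
Qed.

Lemma root_seq_contr n u : sq (root_seq n u) <= sq u.
Proof.
apply: le_trans (cone_bound u (root_seq_cone n)) _.
rewrite ler_piMl ?sq_ge0 // expr_le1 // ?root_sum_le1 //.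
exact: cone_ge0 (root_seq_cone n).
Qed.

Lemma root_seq_tends u : exists l, tends \oo (fun n => root_seq n u) l.
Proof.
pose s := sup (range root_sum).
have hs : has_sup (range root_sum).
  by split; [exists (root_sum 0), 0|exists 1 => _ [n _ <-]; exact: root_sum_le1].
have rs n : root_sum n <= s by apply: sup_upper_bound => //; exists n.
pose E d : set H := [set root_seq n u | n in [set n | s - d < root_sum n]].
have [|||l lE] := @cantor_intersection _ _ E.
- by move=> d /(sup_adherent)-/(_ _ hs)[_ [n _ <-] nd]; exists (root_seq n u), n.
- move=> d d' _ dd' _ [n nd <-]; exists n => //=; apply: le_lt_trans nd.
  by rewrite lerD2l lerN2.
- move=> e e0; have S0 : 0 < 1 + sq u by have := sq_ge0 u; lra.
  pose d := Num.min 1 (e / (1 + sq u)).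
  have d0 : 0 < d by rewrite lt_min ltr01 divr_gt0.
  exists d => // x y [n nd <-] [m md <-].
  wlog nm : n m x y nd md / (n <= m)%N.
    move=> h; case: (leqP n m) => [/h|/ltnW/h] //; first exact.
    rewrite -[sq (_ - _)]opprK -ipNl -ipNr opprB; apply => //.
  rewrite -[sq (_ - _)]opprK -ipNl -ipNr opprB.
  have := cone_bound u (root_seq_diff n (m - n)).
  rewrite /= subnKC // => /le_lt_trans; apply.
  have := rs m; have := root_sum_le n (m - n); rewrite subnKC //.
  move: nd md => /=; have : d <= 1 by rewrite ge_min lexx.
  have : d * (1 + sq u) <= e by rewrite -ler_pdivlMr // ge_min lexx orbT.
  have := sq_ge0 u; move: (sq u) (root_sum n) (root_sum m) => q a b q0 dq d1 ad bd ab bs.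
  have : (b - a) ^+ 2 <= d by nra.
  by nra.
exists l => e e0; have [d d0 dE] := lE _ e0.
have [_ [N _ <-] Nd] := sup_adherent d0 hs.
exists N => // n Nn; apply: dE; exists n => //=; apply: lt_le_trans Nd _.
by rewrite -(subnKC Nn); exact: root_sum_le.
Qed.

End Root.

(** The contraction hypothesis encodes [0 <= Z <= 2]. The root inherits it, so roots can be
    iterated; being a limit of polynomials in [Z], the root also commutes with what commutes with
    [Z]. *)
Lemma op_sqrt Z : is_lin Z -> is_sym Z -> (forall u, sq (u - Z u) <= sq u) ->
  exists z : H -> H, [/\ is_lin z, is_sym z, forall u, sq (u - z u) <= sq u,
    forall u, z (z u) = Z u &
    forall W, is_lin W -> is_sym W -> (forall u, W (Z u) = Z (W u)) ->
      forall u, W (z u) = z (W u)].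
Proof.
move=> Zlin Zsym Zc; pose X u := u - Z u.
have Xlin : is_lin X by move=> c x y; rewrite /X Zlin scalerBr opprD addrACA.
have Xsym : is_sym X by move=> x y; rewrite /X !ipE Zsym.
have [y yE] := choice (root_seq_tends Xlin Zc).
have cn n : cone X _ (root_seq X n) := root_seq_cone X n.
have ysym : is_sym y.
  move=> u v; rewrite (ipC u); apply: (tends_ip_eq _ (yE u) (yE v)); apply: nearW => n.
  by rewrite (cone_sym Xlin Xsym (cn n)) ipC.
have ylin : is_lin y.
  apply: is_sym_lin => // c u; apply: ip_inj => v; rewrite ipZc.
  apply: (tends_ip_eq _ (yE _) (yE _)); apply: nearW => n.
  by rewrite (is_linZ _ _ (cone_lin Xlin (cn n))) ipZc.
have yc u : sq (y u) <= sq u.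
  have : sq (y u) <= (sq u + sq (y u)) / 2.
    apply: (tends_ip_le _ (yE u)) => e e0; apply: nearW => n.
    by have := root_seq_contr Zc n u; have := ip_le (root_seq X n u) (y u); lra.
  by lra.
have yy u : u - y u - y (u - y u) = Z u.
  rewrite is_linB //; apply: ip_inj => v.
  have t2 : tends \oo (fun n => X u + root_seq X n (root_seq X n u)) (X u + y (y u)).
    move=> e e0; have e4 : 0 < e / 4 by rewrite divr_gt0.
    apply: filterS2 (yE u _ e4) (yE (y u) _ e4) => n n1 n2.
    have -> : X u + root_seq X n (root_seq X n u) - (X u + y (y u)) =
        root_seq X n (root_seq X n u - y u) + (root_seq X n (y u) - y (y u)).
      rewrite (is_linB _ _ (cone_lin Xlin (cn n))).
      by apply: ip_inj => z; rewrite !ipE; ring.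
    have := sqD_le (root_seq X n (root_seq X n u - y u)) (root_seq X n (y u) - y (y u)).
    by have := root_seq_contr Zc n (root_seq X n u - y u); lra.
  have t1 : tends \oo (fun n => root_seq X n.+1 u) (y u).
    by move=> e /(yE u)[N _ NE]; exists N => // n Nn; apply: NE; exact: leqW.
  have h n : ip (root_seq X n.+1 u) (2%:C *: v) =
      ip (X u + root_seq X n (root_seq X n u)) v by rewrite /= !ipE; field.
  have : ip (y u) (2%:C *: v) = ip (X u + y (y u)) v.
    by apply: (tends_ip_eq _ t1 t2); apply: nearW.
  by rewrite /X !ipE; lra.
exists (fun u => u - y u); split => //.
- by move=> c u v; rewrite ylin scalerBr opprD addrACA.
- by move=> u v; rewrite !ipE ysym.
- by move=> u; rewrite opprB addrC subrK.
- move=> W Wlin Wsym WZ u; rewrite is_linB //; congr (_ - _).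
  apply: ip_inj => v; rewrite Wsym; apply: (tends_ip_eq _ (yE _) (yE _)); apply: nearW => n.
  rewrite -Wsym (cone_comm Wlin _ (cn n)) // => w.
  by rewrite /X is_linB // WZ.
Qed.

End SquareRoot.

(** * Roots of nonnegative selfadjoint relations *)

Section RelationRoot.
Context {R : realType} {H : hilbertType R}.
Implicit Types (x y z u v w : H) (K : set H) (A B : set (H * H)).

Lemma nsa_uniq1 K A p q : nonneg_selfadjoint K A -> A p -> A q ->
  p.1 + p.2 = q.1 + q.2 -> p = q.
Proof.
move=> hA Ap Aq pq; apply: (nsa_uniq hA Ap Aq ltr01).
by rewrite !scale1r addrC pq addrC.
Qed.

Lemma nsa_bounded K (Z : H -> H) : closed_subspace K -> is_lin Z -> is_sym Z ->
  (forall u, K u -> K (Z u)) -> (forall u, K u -> 0 <= ip (Z u) u) ->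
  nonneg_selfadjoint K [set p | K p.1 /\ p.2 = Z p.1].
Proof.
move=> hK Zlin Zsym ZK Z0; apply: nsa_intro_adj => //.
- by split; [exact: subspace0|rewrite /= is_lin0].
- by move=> c p q [Kp ->] [Kq ->]; split; [exact: subspace_comb|rewrite /= Zlin].
- by move=> p [Kp ->]; split => //; exact: ZK.
- by move=> p q [Kp ->] [Kq ->]; rewrite Zsym.
- by move=> p [Kp ->]; exact: Z0.
- move=> q K1 K2 h; split => //; apply/eqP; rewrite -subr_eq0; apply/eqP/sq_eq0.
  have Kd : K (q.2 - Z q.1) by apply: subspaceB => //; exact: ZK.
  have /= := h (_, Z (q.2 - Z q.1)) (conj Kd erefl); rewrite Zsym => h2.
  by rewrite ipDr ipNr h2 subrr.
Qed.

(* With b^2 = (B + 1)^-1 and a^2 = 1 - b^2 on K, B is the set of the pairs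
   (b (b u), a (a u)) and its root is the set of the pairs (b u, a u). *)
Lemma nsa_root K B : closed_subspace K -> nonneg_selfadjoint K B ->
  exists S, nonneg_selfadjoint K S /\ rcomp S S = B.
Proof.
move=> hK hB.
(* Projecting first extends the resolvent by 0 to the complement of [K], so that [op_sqrt] applies
   on all of [H]. *)
have [f fE] : exists f : H -> H * H, forall u, B (f u) /\ (f u).1 + (f u).2 = oproj K u.
  have /choice[f fE] : forall u, exists p, B p /\ p.1 + p.2 = oproj K u.
    by move=> u; have [p Bp pE] := nsa_surj hK hB (oprojL hK u); exists p.
  by exists f.
have fB u : B (f u) by have [] := fE u.
have fD u : (f u).1 + (f u).2 = oproj K u by have [] := fE u.
have K1 u : K (f u).1 by exact: nsa_dom hB _ (fB u).
have K2 u : K (f u).2 by exact: nsa_ran hB _ (fB u).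
have funiq u p : B p -> p.1 + p.2 = oproj K u -> f u = p.
  by move=> Bp pE; apply: (nsa_uniq1 hB) => //; rewrite fD.
have flin c u v : f (c *: u + v) = (c *: (f u).1 + (f v).1, c *: (f u).2 + (f v).2).
  apply: funiq; first exact: nsa_comb hB c _ _ (fB u) (fB v).
  by rewrite /= oproj_comb // -!fD scalerDr addrACA.
have ipK w v : K w -> ip w v = ip w (f v).1 + ip w (f v).2.
  by move=> Kw; rewrite -ipDr fD -oproj_sym // oproj_id.
pose r u := (f u).1; pose t u := (f u).2.
have rlin : is_lin r by move=> c x y; rewrite /r flin.
have tlin : is_lin t by move=> c x y; rewrite /t flin.
have fsym u v := nsa_sym hB (fB u) (fB v).
have rsym : is_sym r.
  move=> x y; rewrite /r (ipC x) (ipK _ y (K1 x)) (ipK _ x (K1 y)) (ipC (f y).1 (f x).1).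
  by rewrite (ipC (f y).1) fsym.
have tsym : is_sym t.
  move=> x y; rewrite /t (ipC x) (ipK _ y (K2 x)) (ipK _ x (K2 y)) (ipC (f y).2 (f x).2).
  by rewrite (ipC (f y).2) fsym.
(* On the complement of [K], [r] and [t] vanish and [1 - r], [1 - t] are the identity; on [K] they
   are [t] and [r]. *)
have bound u w : K w -> sq w <= sq (oproj K u) -> sq (u - oproj K u + w) <= sq u.
  move=> Kw wu; rewrite (sq_oproj hK u).
  have : ip (u - oproj K u) w = 0 by rewrite ipDl ipNl oprojE // subrr.
  by rewrite !(ipDl _ w) !(ipDr _ w) (ipC w) => ->; lra.
have sqf u : sq (f u).1 + sq (f u).2 <= sq (oproj K u).
  by rewrite -fD; exact: sq_nsa hB (fB u).
have rc u : sq (u - r u) <= sq u.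
  have -> : u - r u = u - oproj K u + t u.
    by apply: ip_inj => z; rewrite /r /t -fD !ipE; ring.
  by apply: bound; [exact: K2|have := sqf u; have := sq_ge0 (f u).1; rewrite /t; lra].
have tc u : sq (u - t u) <= sq u.
  have -> : u - t u = u - oproj K u + r u.
    by apply: ip_inj => z; rewrite /r /t -fD !ipE; ring.
  by apply: bound; [exact: K1|have := sqf u; have := sq_ge0 (f u).2; rewrite /r; lra].
have [b [blin bsym bc bb bcomm]] := op_sqrt rlin rsym rc.
have [a [alin asym ac aa acomm]] := op_sqrt tlin tsym tc.
have [b' [blin' bsym' bc' bb' bcomm']] := op_sqrt blin bsym bc.
have Plin : is_lin (oproj K) by move=> c x y; rewrite oproj_comb.
have Psym : is_sym (oproj K) by move=> x y; exact: oproj_sym.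
have fP u : f (oproj K u) = f u.
  by apply: funiq => //; rewrite fD [RHS]oproj_id //; exact: oprojL.
have Pb u : oproj K (b u) = b (oproj K u).
  by apply: bcomm => // w; rewrite /r fP oproj_id.
have Pa u : oproj K (a u) = a (oproj K u).
  by apply: acomm => // w; rewrite /t fP oproj_id.
have ba u : b (a u) = a (b u).
  apply: acomm => // w.
  have tE v : t v = oproj K v - b (b v) by rewrite bb -fD /r /t addrAC subrr add0r.
  by rewrite !tE (is_linB _ _ blin) Pb.
have ab' u : a (b' u) = b' (a u) by apply: bcomm' => // w; rewrite ba.
have Kb u : K u -> K (b u) by move=> Ku; rewrite -(oproj_id hK Ku) -Pb; exact: oprojL.
have Ka u : K u -> K (a u) by move=> Ku; rewrite -(oproj_id hK Ku) -Pa; exact: oprojL.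
have one u : K u -> b (b u) + a (a u) = u.
  by move=> Ku; rewrite bb aa fD oproj_id.
(* With [b'] a root of [b], this is the quadratic form of [a] at [b' u], and [1 - a] being a
   contraction makes it nonnegative. *)
have pos u : 0 <= ip (a (b u)) u.
  rewrite -bb' ab' bsym'; have := ac (b' u); rewrite !ipE (ipC _ (a _)).
  by have := sq_ge0 (a (b' u)); lra.
exists [set p | exists2 x, K x & p = (b x, a x)]; split.
  apply: nsa_intro_surj => //.
  - by exists 0; [exact: subspace0|rewrite !is_lin0].
  - move=> c _ _ [x Kx ->] [y Ky ->]; exists (c *: x + y); first exact: subspace_comb.
    by rewrite blin alin.
  - by move=> _ [x Kx ->]; split; [exact: Kb|exact: Ka].
  - by move=> _ _ [x Kx ->] [y Ky ->] /=; rewrite asym bsym ba.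
  - by move=> _ [x Kx ->] /=; rewrite -bsym ba.
  (* On [K], [a^2 + b^2 = 1] gives [(a + b)^2 = 1 + 2 a b]. If [x + Z x = g], then [w = (a + b) x]
     solves [(a + b) w = g]. *)
  move=> g Kg; pose Z u := 2%:C *: a (b u).
  have hZ : nonneg_selfadjoint K [set p | K p.1 /\ p.2 = Z p.1].
    apply: nsa_bounded => //.
    - by move=> c x y; rewrite /Z blin alin scalerDr !scalerA mulrC.
    - by move=> x y; rewrite /Z !ipE asym bsym ba.
    - by move=> u Ku; apply: subspaceZ => //; exact/Ka/Kb.
    - by move=> u Ku; rewrite /Z !ipE; have := pos u; lra.
  have [[x _] [/= Kx ->] <-] := nsa_surj hK hZ Kg.
  exists (b (a x + b x), a (a x + b x)).
    by exists (a x + b x) => //; apply: subspaceD => //; [exact: Ka|exact: Kb].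
  rewrite /= (is_linD _ _ alin) (is_linD _ _ blin) ba /Z.
  transitivity (b (b x) + a (a x) + 2%:C *: a (b x)); last by rewrite one.
  by apply: ip_inj => z; rewrite !ipE; ring.
apply/seteqP; split.
  move=> p [g [[x Kx [p1 gx]] [y Ky [gy p2]]]].
  have xy : a x = b y by rewrite -gx.
  (* For [w = b x + a y], the relation [a x = b y] yields [b w = x] and [a w = y]. *)
  suff -> : p = f (b x + a y) by [].
  rewrite (surjective_pairing p) (surjective_pairing (f _)) p1 p2; congr (_, _).
    by rewrite -[RHS]bb (is_linD _ _ blin) ba -xy one.
  by rewrite -[RHS]aa (is_linD _ _ alin) -ba xy one.
move=> p Bp; pose u := p.1 + p.2.
have Ku : K u by apply: subspaceD => //; [exact: nsa_dom hB _ Bp|exact: nsa_ran hB _ Bp].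
have pE : f u = p by apply: funiq => //; rewrite oproj_id.
exists (a (b u)); rewrite -pE; split.
  by exists (b u); [exact: Kb|rewrite bb].
by exists (a u); [exact: Ka|rewrite aa ba].
Qed.

End RelationRoot.

(** * Closed forms *)

Section Forms.
Context {R : realType} {H : hilbertType R}.
Implicit Types (x y z u v w : H) (K : set H) (A B : set (H * H)).

Section OneForm.
Context (A : set (H * H)) (hA : nonneg_selfadjoint setT A).

Let S := form_root setT A.
Let O := ominus setT (rmul A).
Let hT : closed_subspace [set: H] := closed_subspaceT.
Let hO : closed_subspace O := closed_subspace_ominus _ closed_subspaceT.

Lemma form_root_spec : nonneg_selfadjoint O S /\ rcomp S S = opart setT A.
Proof.
have [S' hS'] := nsa_root hO (nsa_opart hT hA).
apply: (@getPex _ [set S | nonneg_selfadjoint O S /\ rcomp S S = opart setT A]).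
by exists S'.
Qed.

Let hS : nonneg_selfadjoint O S := form_root_spec.1.

Lemma form_root_comp f h k : S (f, h) -> S (h, k) -> opart setT A (f, k).
Proof. by move=> fh hk; rewrite -form_root_spec.2; exists h. Qed.

Lemma form_root_split p : opart setT A p -> exists2 h, S (p.1, h) & S (h, p.2).
Proof. by rewrite -form_root_spec.2 => -[h [h1 h2]]; exists h. Qed.

Lemma form_root_inj f h h' : S (f, h) -> S (f, h') -> h = h'.
Proof.
move=> fh fh'; have := nsaB hS fh fh'; rewrite /= subrr => h0.
have [A0 [_ /= [_ hO']]] := form_root_comp (nsa0 hS) h0.
apply/eqP; rewrite -subr_eq0; apply/eqP/sq_eq0.
by have := hO' _ A0; rewrite /ip => ->.
Qed.

Lemma formE f h : S (f, h) -> Defs.form setT A f = (sq h)%:C.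
Proof.
move=> fh; have hg : S (f, rapp S f).
  exact: (@getPex _ [set f' | S (f, f')] (ex_intro _ h fh)).
by rewrite /Defs.form ip_norm (form_root_inj hg fh).
Qed.

Lemma form_domP f : form_dom setT A f <-> exists h, S (f, h).
Proof. by split=> [[[g h] /= gh <-]|[h fh]]; [exists h|exists (f, h)]. Qed.

Lemma form_root_attain p : A p -> exists2 h, S (p.1, h) & sq h = ip p.2 p.1.
Proof.
move=> Ap; have Op := nsa_proj_ran hA hT Ap.
have [h fh hk] := form_root_split Op; exists h => //.
have /= -> := nsa_sym hS fh hk; rewrite -/O ipC oprojE //.
exact: nsa_dom_ominus hA Ap.
Qed.

(** Half of the variational formula, at [u = p.1 + p.2]. With [k] the value of the root at [p.1], it
    expands [0 <= sq (p.1 - f) + sq (k - h)]. *)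
Lemma form_root_upper f h p : S (f, h) -> A p ->
  ip (p.1 + p.2) f *+ 2 - ip p.1 (p.1 + p.2) <= sq f + sq h.
Proof.
move=> fh Ap; have Op := nsa_proj_ran hA hT Ap.
have [k pk kp] := form_root_split Op.
have /= e1 := nsa_sym hS kp fh; have /= e2 := nsa_sym hS pk kp.
rewrite -/O oprojE // in e1; last exact: nsa_dom hS _ fh.
rewrite -/O ipC oprojE // in e2; last exact: nsa_dom_ominus hA Ap.
have := ip_le p.1 f; have := ip_le k h.
by rewrite !ipE (ipC p.1 p.2); lra.
Qed.

Lemma ominus_rmul f (M : R) : (forall m, A (0, m) -> ip m f *+ 2 <= M) -> O f.
Proof.
move=> hM; have orth m : A (0, m) -> ip f m = 0.
  move=> Am; rewrite ipC; apply/eqP; apply: contrapT => /negP mf.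
  have := nsaZ hA ((M + 1) / (2 * ip m f))%:C Am; rewrite /= scaler0 => /hM.
  have -> : ip (((M + 1) / (2 * ip m f))%:C *: m) f *+ 2 = M + 1.
    by rewrite ipE; field.
  lra.
split => // m Am; rewrite innerE orth // ipiN orth ?oppr0 //.
by have := nsaZ hA 'i Am; rewrite /= scaler0.
Qed.

(** The other half, which also yields membership in the form domain. Since
    [|(S + i) f1|^2 = |f1|^2 + |S f1|^2], the bound makes [(S + i) f1 |-> (f1 + S^2 f1, f)] a
    bounded functional. Its Riesz vector [y] should be [(S + i) f], as [1 + S^2 = (S - i) (S + i)];
    so [f] is recovered as [(S - i) v], with [v] the image under [(1 + S^2)^-1] of the projection of
    [y] onto [O]. *)
Lemma form_root_lower f (M : R) :
  (forall p, A p -> ip (p.1 + p.2) f *+ 2 - ip p.1 (p.1 + p.2) <= M) ->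
  exists2 h, S (f, h) & sq f + sq h <= M.
Proof.
move=> hM.
have Of : O f.
  by apply: (@ominus_rmul _ M) => m /hM; rewrite /= add0r ip0l subr0.
have ipS0 x y : S (x, y) -> ip y ('i *: x) = 0.
  by move=> xy; have /= := nsa_sym hS xy (nsaZ hS 'i xy); have := ipiN x y; rewrite (ipC y); lra.
have [||||y [_ yl yM]] := @riesz _ _ [set r | exists f1 h1 k1, [/\ S (f1, h1), S (h1, k1) &
    r = (h1 + 'i *: f1, ip (f1 + k1) f)]] M.
- exists 0, 0, 0; split; [exact: nsa0 hS|exact: nsa0 hS|].
  by rewrite scaler0 !addr0 ip0l.
- move=> _ _ [f1 [h1 [k1 [fh1 hk1 ->]]]] [f2 [h2 [k2 [fh2 hk2 ->]]]].
  exists (f1 + f2), (h1 + h2), (k1 + k2).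
  split; [exact: (nsaD hS fh1 fh2)|exact: (nsaD hS hk1 hk2)|].
  by congr (_, _) => /=; [rewrite scalerDr addrACA|rewrite !ipE; ring].
- move=> r _ [f1 [h1 [k1 [fh1 hk1 ->]]]].
  exists (r%:C *: f1), (r%:C *: h1), (r%:C *: k1).
  split; [exact: (nsaZ hS _ fh1)|exact: (nsaZ hS _ hk1)|].
  by congr (_, _) => /=; [rewrite scalerDr !scalerA mulrC|rewrite !ipE; ring].
- move=> _ [f1 [h1 [k1 [fh1 hk1 ->]]]] /=.
  have [/hM] := form_root_comp fh1 hk1; rewrite /=.
  have /= := nsa_sym hS fh1 hk1; have := ipS0 _ _ fh1.
  by rewrite !ipE ipi (ipC ('i *: _)); lra.
have [[v w] Avw vw] := nsa_surj hO (nsa_opart hT hA) (oprojL hO y).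
have [k /= vk kw] := form_root_split Avw.
have Sk : S (k - 'i *: v, w - 'i *: k).
  have := nsa_comb hS (- 'i) vk kw; rewrite /= !scaleNr.
  by rewrite ![- _ + _]addrC.
have fE : f = k - 'i *: v.
  apply/eqP; rewrite -subr_eq0; apply/eqP/sq_eq0.
  set d := f - _; have Od : O d by apply: subspaceB => //; exact: nsa_dom hS _ Sk.
  (* [d] is orthogonal to all vectors [f1 + S^2 f1], and it is itself one of them. *)
  have [[f1 k1] A1 dE] := nsa_surj hO (nsa_opart hT hA) Od.
  have [h1 /= fh1 hk1] := form_root_split A1.
  have := yl _ (ex_intro _ f1 (ex_intro _ h1 (ex_intro _ k1 (And3 fh1 hk1 erefl)))).
  rewrite /=; have Oy : O (h1 + 'i *: f1).
    by rewrite addrC; apply: subspace_comb => //; [exact: nsa_dom hS _ fh1|exact: nsa_ran hS _ fh1].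
  rewrite -(oproj_id hO Oy) oproj_sym // -vw.
  have /= e1 := nsa_sym hS fh1 vk; have /= e2 := nsa_sym hS hk1 kw.
  have /= e3 := nsa_sym hA A1.1 (nsaZ hA 'i Avw.1).
  move=> /= yE; rewrite -[X in ip X _]dE /= /d ipDr ipNr yE.
  by rewrite !ipE !(ipiN f1) e1 e2 e3; lra.
exists (w - 'i *: k); first by rewrite fE.
(* The sum of squares to be bounded equals [sq (v + w)], the squared norm of the projection of
   [y]. *)
have := sq_oproj hO y; rewrite -vw /=.
have := sq_ge0 (y - (v + w)); rewrite fE.
have := ipS0 _ _ vk; have := ipS0 _ _ kw; have /= := nsa_sym hS vk kw.
rewrite !ipE !ipi (ipC ('i *: _) k) (ipC ('i *: _) w) (ipC w v).
lra.
Qed.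

End OneForm.

(** For pairs with common sum [u], [ip p.2 u] is [(X u, u)]. Left to right, the forms are compared
    at [q.1], where [q] attains the supremum for [B]; right to left, the suprema are compared. *)
Lemma form_leP A B : nonneg_selfadjoint setT A -> nonneg_selfadjoint setT B ->
  form_le setT A B <-> (forall p q, A p -> B q -> p.1 + p.2 = q.1 + q.2 ->
    ip p.2 (p.1 + p.2) <= ip q.2 (q.1 + q.2)).
Proof.
move=> hA hB; split=> [[AB1 AB2] p q Ap Bq pq|AB].
  have [h qh hE] := form_root_attain hB Bq.
  have qB : form_dom setT B q.1 by apply/form_domP; exists h.
  have /form_domP[h' qh'] := AB1 _ qB.
  have := AB2 _ qB; rewrite (formE hB qh) (formE hA qh') lecR hE => hh.
  have := form_root_upper hA qh' Ap; rewrite pq.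
  have : ip p.1 (q.1 + q.2) + ip p.2 (q.1 + q.2) = sq (q.1 + q.2) by rewrite -ipDl pq.
  move: hh; rewrite !ipE (ipC q.2 q.1); lra.
have key f h : form_root setT B (f, h) -> exists2 h', form_root setT A (f, h') & sq h' <= sq h.
  move=> fh; have [|h' fh' hh] := @form_root_lower _ hA f (sq f + sq h).
    move=> p Ap; have [q Bq qp] := nsa_surj closed_subspaceT hB (I : setT (p.1 + p.2)).
    have := form_root_upper hB fh Bq; have := AB _ _ Ap Bq (esym qp).
    have : ip p.1 (p.1 + p.2) + ip p.2 (p.1 + p.2) = ip q.1 (p.1 + p.2) + ip q.2 (p.1 + p.2).
      by rewrite -!ipDl qp.
    rewrite qp; lra.
  by exists h' => //; lra.
split=> f /form_domP[h fh]; have [h' fh' hh] := key _ _ fh.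
  by apply/form_domP; exists h'.
by rewrite (formE hA fh') (formE hB fh) lecR.
Qed.

End Forms.

(** * The relations -M(-s) and their limit *)

Section Compression.
Context {R : realType} {H : hilbertType R}.
Implicit Types (x y z u v w g : H) (K L : set H) (A B : set (H * H)).

(* The relation -M_{A,L}(-s), which is the short of A + s to L, minus s. *)
Definition nrel A L (s : R) : set (H * H) :=
  [set q | exists2 p, A p & q = (oproj L p.1, oproj L p.2) /\
    p.2 - oproj L p.2 = - (s%:C *: (p.1 - oproj L p.1))].

Section OneRelation.
Context (A : set (H * H)) (L : set H).
Hypotheses (hA : nonneg_selfadjoint setT A) (hL : closed_subspace L).

Let P := oproj L.

Lemma oproj_compl x y : ip (P x) (y - P y) = 0.
Proof. by rewrite ipDr ipNr oproj_idem // subrr. Qed.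

(** On these pairs [P p.2 = p.2 + s (1 - P) p.1], so symmetry and nonnegativity come from
    [A + s (1 - P)]. The range condition is the weighted equation with weight 1 on [L] and [s] off
    it. *)
Lemma nsa_nrel (s : R) : 0 < s -> nonneg_selfadjoint L (nrel A L s).
Proof.
move=> s0; have s1 : 0 < Num.sqrt s by rewrite sqrtr_gt0.
have E p : p.2 - P p.2 = - (s%:C *: (p.1 - P p.1)) ->
    P p.2 = p.2 + s%:C *: (p.1 - P p.1).
  by move=> h; apply: ip_inj => z; have := congr1 (fun w => ip w z) h; rewrite !ipE; lra.
apply: nsa_intro_surj => //.
- by exists (0, 0); [exact: nsa0 hA|rewrite /= oproj0 // subrr scaler0 oppr0].
- move=> c _ _ [p Ap [-> pE]] [q Aq [-> qE]].
  exists (c *: p.1 + q.1, c *: p.2 + q.2); first exact: (nsa_comb hA c Ap Aq).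
  split; first by rewrite /= !oproj_comb.
  have dE (x y x' y' : H) : c *: x + y - (c *: x' + y') = c *: (x - x') + (y - y').
    by rewrite opprD addrACA -scalerBr.
  rewrite /= !(oproj_comb hL) !dE pE qE.
  move: (p.1 - _) (q.1 - _) => x y.
  by rewrite scalerN scalerDr opprD !scalerA [c * _]mulrC.
- by move=> _ [p Ap [-> _]]; split; exact: oprojL.
- move=> _ _ [p Ap [-> pE]] [q Aq [-> qE]] /=.
  rewrite (ipC (oproj L p.1)) !oproj_idem // -/P (E _ pE) (E _ qE) !ipE.
  rewrite (nsa_sym hA Ap Aq) (ipC q.2) (ipC q.1) (ipC (P q.1)).
  by rewrite -(oproj_sym hL p.1); ring.
- move=> _ [p Ap [-> pE]] /=; rewrite oproj_idem // -/P (E _ pE) !ipE.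
  have := nsa_ge0 hA Ap; have := sq_oproj hL p.1; rewrite -/P => e1.
  have : ip (P p.1) (P p.1) = ip (P p.1) p.1 by rewrite oproj_idem.
  have := sq_ge0 (p.1 - P p.1); nra.
- move=> g Lg; have [p Ap pE] := weighted_surj g hA hL ltr01 s1.
  rewrite expr1n scale1r sqr_sqrtr in pE; last exact: ltW.
  have PE : P p.1 + P p.2 = g.
    rewrite -[RHS](oproj_id hL Lg) -pE oprojD // oprojD // oprojZ // oprojD // oprojN //.
    by rewrite [oproj L (oproj L _)]oproj_id ?subrr ?scaler0 ?addr0 1?addrC //; exact: oprojL.
  exists (P p.1, P p.2) => //; exists p => //; split => //.
  by apply: ip_inj => z; have := congr1 (fun w => ip w z) (etrans pE (esym PE)); rewrite !ipE; lra.
Qed.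

(* p solves (A + P + s (1 - P)) f = g. *)
Definition nsol (s : R) g (p : H * H) :=
  A p /\ p.2 + P p.1 + s%:C *: (p.1 - P p.1) = g.

Lemma nsol_ex (s : R) g : 0 < s -> exists p, nsol s g p.
Proof.
move=> s0; have s1 : 0 < Num.sqrt s by rewrite sqrtr_gt0.
have [p Ap pE] := weighted_surj g hA hL ltr01 s1; exists p; split => //.
by rewrite expr1n scale1r sqr_sqrtr ?addrA // in pE; exact: ltW.
Qed.

Lemma nsolE (s : R) g p : L g -> nsol s g p ->
  nrel A L s (P p.1, P p.2) /\ P p.1 + P p.2 = g.
Proof.
move=> Lg [Ap pE].
have PE : P p.1 + P p.2 = g.
  rewrite -[RHS](oproj_id hL Lg) -pE oprojD // oprojD // oprojZ // oprojD // oprojN //.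
  by rewrite !(oproj_id hL (oprojL hL _)) subrr scaler0 addr0 addrC.
split => //; exists p => //; split => //.
by apply: ip_inj => z; have := congr1 (fun w => ip w z) (etrans pE (esym PE)); rewrite !ipE; lra.
Qed.

(** Let [c], [d] be the components of [p.1], [r.1] off [L]. Symmetry of [A] turns the right-hand
    side into [(t - s) * ip c d], and nonnegativity of [A] on the difference of the pairs bounds the
    left-hand side by this. *)
Lemma nsol_monotone (s t : R) g p r : 0 < s -> s <= t -> L g -> nsol s g p -> nsol t g r ->
  sq (P p.1 - P r.1) <= ip (P p.1) g - ip (P r.1) g.
Proof.
move=> s0 st Lg [Ap pE] [Ar rE].
have p2 z : ip p.2 z = ip g z - ip (P p.1) z - s * ip (p.1 - P p.1) z.
  by rewrite -pE !ipE; ring.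
have r2 z : ip r.2 z = ip g z - ip (P r.1) z - t * ip (r.1 - P r.1) z.
  by rewrite -rE !ipE; ring.
have Og x : ip g (x - P x) = 0 by rewrite -(oproj_id hL Lg); exact: oproj_compl.
have := nsa_ge0 hA (nsaB hA Ap Ar); have := nsa_sym hA Ap Ar.
rewrite /= (ipC p.1) [ip (p.2 - r.2) _]ipDl ipNl !p2 !r2.
have [dp dr] : p.1 = P p.1 + (p.1 - P p.1) /\ r.1 = P r.1 + (r.1 - P r.1).
  by split; rewrite addrC subrK.
have := oproj_compl p.1 p.1; have := oproj_compl p.1 r.1.
have := oproj_compl r.1 p.1; have := oproj_compl r.1 r.1.
have := Og p.1; have := Og r.1.
move: dp dr {p2 r2 pE rE Ap Ar}.
move: (P p.1) (P r.1) (p.1 - P p.1) (r.1 - P r.1) => a b c d -> ->.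
rewrite !ipE (ipC b a) (ipC d c) (ipC c a) (ipC c b) (ipC d a) (ipC d b).
rewrite (ipC a g) (ipC b g) => -> -> -> -> -> ->.
have := ler_wpM2l (ltW s0) (ip_le c d).
have : 0 <= (t - s) * sq d by rewrite mulr_ge0 ?sq_ge0 // subr_ge0.
lra.
Qed.

Lemma nsol_le (s : R) g p : 0 < s -> L g -> nsol s g p -> ip (P p.1) g <= sq g.
Proof.
move=> s0 Lg /(nsolE Lg)[Np pE]; have := nsa_ge0 (nsa_nrel s0) Np => /=.
rewrite -pE !ipE (ipC (P p.2) (P p.1)).
by have := sq_ge0 (P p.1); have := sq_ge0 (P p.2); lra.
Qed.

Lemma nsol_limit g : L g -> exists v, forall e : R, 0 < e ->
  exists2 d, 0 < d & forall s p, 0 < s -> s <= d -> nsol s g p -> sq (P p.1 - v) < e.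
Proof.
move=> Lg; pose Q := [set x | exists s p, [/\ 0 < s, nsol s g p & x = ip (P p.1) g]].
have hQ : has_sup Q.
  split; last by exists (sq g) => _ [s [p [s0 sp ->]]]; exact: nsol_le sp.
  by have [p sp] := nsol_ex g ltr01; exists (ip (P p.1) g), 1, p.
pose E d : set H := [set P p.1 | p in [set p | exists s, [/\ 0 < s, s <= d & nsol s g p]]].
have [|||v vE] := @cantor_intersection _ _ E.
- by move=> d d0; have [p sp] := nsol_ex g d0; exists (P p.1), p => //; exists d.
- move=> d d' _ dd' _ [p [s [s0 sd sp]] <-]; exists p => //; exists s; split => //.
  exact: le_trans dd'.
- move=> e e0; have e4 : 0 < e / 4 by rewrite divr_gt0.
  have [_ [t [r [t0 tr ->]]] rQ] := sup_adherent e4 hQ.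
  have near s p : 0 < s -> s <= t -> nsol s g p -> sq (P p.1 - P r.1) < e / 4.
    move=> s0 st sp; apply: le_lt_trans (nsol_monotone s0 st Lg sp tr) _.
    have : ip (P p.1) g <= sup Q by apply: sup_upper_bound => //; exists s, p.
    lra.
  exists t => // x y [p [s [s0 sd sp]] <-] [q [s' [s0' sd' sq']] <-].
  have hp := near _ _ s0 sd sp; have hq := near _ _ s0' sd' sq'.
  have -> : P p.1 - P q.1 = (P p.1 - P r.1) + - (P q.1 - P r.1).
    by apply: ip_inj => z; rewrite !ipE; ring.
  have := sqD_le (P p.1 - P r.1) (- (P q.1 - P r.1)).
  by rewrite (ipNl (P q.1 - P r.1)) (ipNr (P q.1 - P r.1)); lra.
exists v => e /vE[d d0 dE]; exists d => // s p s0 sd sp.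
by apply: dE; exists p => //; exists s.
Qed.

End OneRelation.

End Compression.

(** * The limit relation and the extremality of its extension *)

Section LimitRelation.
Context {R : realType} {H : hilbertType R}.
Implicit Types (x y z u v w g : H) (K L : set H) (A B C : set (H * H)).

Lemma near_at_right0 (Q : R -> Prop) d : 0 < d ->
  (forall s, 0 < s -> s <= d -> Q s) -> \forall s \near 0^'+, Q s.
Proof.
move=> d0 dQ; near=> s; apply: dQ; near: s.
  exact: nbhs_right_gt.
exact: nbhs_right_le.
Unshelve. all: by end_near. Qed.

Context (A : set (H * H)) (L : set H).
Hypotheses (hA : nonneg_selfadjoint setT A) (hL : closed_subspace L).

Let P := oproj L.

(** Strong resolvent convergence of [nrel A L s] as [s] decreases to 0, read on pairs: when the sums
    agree, [p.1] and [q.1] are the two resolvents at the same vector. *)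
Definition is_nrel_limit (N : set (H * H)) := forall q, N q ->
  forall e : R, 0 < e -> exists2 d, 0 < d & forall s p, 0 < s -> s <= d ->
    nrel A L s p -> p.1 + p.2 = q.1 + q.2 -> sq (p.1 - q.1) < e.

(** With [V] the strong limit of the resolvents, the relation is [V^-1 - I], multivalued when [V]
    has a kernel. *)
Lemma nrel_limit : exists2 N, nonneg_selfadjoint L N & is_nrel_limit N.
Proof.
have [V VE] : exists V : H -> H, forall g, L g -> forall e : R, 0 < e ->
    exists2 d, 0 < d & forall s p, 0 < s -> s <= d -> nsol A L s g p -> sq (P p.1 - V g) < e.
  have /choice[V VE] : forall g, exists v, L g -> forall e : R, 0 < e ->
    exists2 d, 0 < d & forall s p, 0 < s -> s <= d -> nsol A L s g p -> sq (P p.1 - v) < e.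
    move=> g; have [Lg|nLg] := pselect (L g); last by exists 0.
    by have [v vE] := nsol_limit hA hL Lg; exists v.
  by exists V.
have [f fE] : exists f : H -> R -> H * H, forall g s, 0 < s -> nsol A L s g (f g s).
  have /choice[f fE] : forall gs : H * R, exists p, 0 < gs.2 -> nsol A L gs.2 gs.1 p.
    move=> [g s] /=; have [s0|s0] := pselect (0 < s); last by exists (0, 0).
    by have [p sp] := nsol_ex hA hL g s0; exists p.
  by exists (fun g s => f (g, s)) => g s s0; exact: (fE (g, s) s0).
have fV g : L g -> tends 0^'+ (fun s => P (f g s).1) (V g).
  move=> Lg e /(VE g Lg)[d d0 dE]; apply: (near_at_right0 d0) => s s0 sd.
  exact: (dE s _ s0 sd (fE g s s0)).
pose n g s := (P (f g s).1, P (f g s).2).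
have nN g s : L g -> 0 < s -> nrel A L s (n g s) /\ (n g s).1 + (n g s).2 = g.
  by move=> Lg s0; have [h1 h2] := nsolE hL Lg (fE g s s0); split; [exact: h1|exact: h2].
have LV g : L g -> L (V g).
  move=> Lg; apply: (closed_sq hL.2) => e /(VE g Lg)[d d0 dE].
  by exists (P (f g d).1); [exact: oprojL|exact: (dE d _ d0 (lexx d) (fE g d d0))].
have Vsym g g' : L g -> L g' -> ip (V g) g' = ip (V g') g.
  move=> Lg Lg'; apply: (tends_ip_eq _ (fV g Lg) (fV g' Lg')).
  apply: (near_at_right0 ltr01) => s s0 _.
  have [n1 n2] := nN g s Lg s0; have [m1 m2] := nN g' s Lg' s0.
  have := nsa_sym (nsa_nrel hA hL s0) n1 m1.
  move: n2 m2; rewrite /n /=.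
  move: (P (f g s).1) (P (f g s).2) (P (f g' s).1) (P (f g' s).2) => a b c d <- <-.
  by rewrite !ipDr (ipC c a) (ipC c b) => ->.
have VZ c g : L g -> V (c *: g) = c *: V g.
  move=> Lg; have Lcg := subspaceZ hL c Lg; apply: ip_inj => z; rewrite ipZc.
  apply: (tends_ip_eq _ (fV _ Lcg) (fV g Lg)); apply: (near_at_right0 ltr01) => s s0 _.
  have [n1 n2] := nN g s Lg s0; have [m1 m2] := nN _ s Lcg s0.
  have hN := nsa_nrel hA hL s0.
  have e : n (c *: g) s = (c *: (n g s).1, c *: (n g s).2).
    by apply: (nsa_uniq1 hN m1 (nsaZ hN c n1)); rewrite m2 -scalerDr n2.
  by have := congr1 fst e; rewrite /n /= => ->; rewrite ipZc.
have VP c g g' : L g -> L g' -> V (c *: g + g') = c *: V g + V g'.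
  move=> Lg Lg'; have Lcg := subspaceZ hL c Lg.
  have Lcgg := subspaceD hL Lcg Lg'.
  (* Symmetry moves [V] onto the defect [D], where the terms cancel. *)
  apply/eqP; rewrite -subr_eq0; apply/eqP/sq_eq0; set D := _ - _.
  have LD : L D by apply: subspaceB (LV _ Lcgg) _ => //; apply: subspace_comb => //; exact: LV.
  rewrite {1}/D ipDl ipNl ipDl -VZ // (Vsym _ D) // (Vsym (c *: g) D) // (Vsym g' D) //.
  by rewrite ipDr subrr.
exists [set p | [/\ L p.1, L p.2 & p.1 = V (p.1 + p.2)]].
  apply: nsa_intro_surj => //.
  - split; [exact: subspace0|exact: subspace0|rewrite /= addr0].
    by have := VZ 0 0 (subspace0 hL); rewrite !scale0r.
  - move=> c p q [p1 p2 pV] [q1 q2 qV]; split; [exact: subspace_comb|exact: subspace_comb|].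
    by rewrite /= addrACA -scalerDr VP -?pV -?qV //; exact: subspaceD.
  - by move=> p [].
  - move=> p q [p1 p2 pV] [q1 q2 qV].
    have := Vsym _ _ (subspaceD hL p1 p2) (subspaceD hL q1 q2).
    by rewrite -pV -qV !ipE (ipC q.1 p.1) (ipC q.1 p.2); lra.
  - move=> p [p1 p2 pV]; have Lg := subspaceD hL p1 p2.
    (* The approximants satisfy [sq a <= ip a (p.1 + p.2)]. Bounding [sq a] below by
       [ip a p.1 *+ 2 - sq p.1] leaves an inequality linear in [a], which passes to the limit. *)
    have : ip p.1 (p.1 - p.2) <= sq p.1.
      rewrite {1}pV; apply: (tends_ip_le _ (fV _ Lg)) => e e0.
      apply: (near_at_right0 ltr01) => s s0 _.
      have [n1 n2] := nN _ s Lg s0; have := nsa_ge0 (nsa_nrel hA hL s0) n1.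
      rewrite /=; set a := P (f _ s).1; set b := P (f _ s).2 => ab.
      have : ip a (a + b) = ip a (p.1 + p.2) := congr1 (ip a) n2.
      by move: ab; have := ip_le a p.1; rewrite !ipE (ipC b a); lra.
    by rewrite !ipE (ipC p.2); lra.
  - move=> g Lg; exists (V g, g - V g); last by rewrite /= addrC subrK.
    by split; rewrite /= ?[V g + _]addrC ?subrK //; [exact: LV|apply: subspaceB => //; exact: LV].
move=> q [q1 q2 qV] e e0; have Lg := subspaceD hL q1 q2.
have [d d0 dE] := VE _ Lg _ e0; exists d => // s p s0 sd Np pq.
have [n1 n2] := nN _ s Lg s0.
have -> : p = n (q.1 + q.2) s.
  by apply: (nsa_uniq1 (nsa_nrel hA hL s0) Np n1); rewrite n2.
rewrite [in X in _ - X]qV; exact: (dE s _ s0 sd (fE _ s s0)).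
Qed.

Section Short.
Context (N : set (H * H)).
Hypotheses (hN : nonneg_selfadjoint L N) (Nlim : is_nrel_limit N).

Lemma nrel_limit_tends q : N q -> exists2 f : R -> H * H,
  forall s, 0 < s -> nsol A L s (q.1 + q.2) (f s) &
  tends 0^'+ (fun s => P (f s).1) q.1.
Proof.
move=> Nq; have Lg : L (q.1 + q.2).
  by apply: subspaceD => //; [exact: nsa_dom hN _ Nq|exact: nsa_ran hN _ Nq].
have /choice[f fE] : forall s, exists p, 0 < s -> nsol A L s (q.1 + q.2) p.
  move=> s; have [s0|s0] := pselect (0 < s); last by exists (0, 0).
  by have [p sp] := nsol_ex hA hL (q.1 + q.2) s0; exists p.
exists f => // e e0; have [d d0 dE] := Nlim Nq e0; apply: (near_at_right0 d0) => s s0 sd.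
have [n1 n2] := nsolE hL Lg (fE s s0); exact: dE sd n1 n2.
Qed.

(* When N is the limit of nrel A L s, this is the short of A to L. *)
Definition short_ext : set (H * H) := [set p | N (P p.1, p.2)].

Lemma nsa_short_ext : nonneg_selfadjoint setT short_ext.
Proof.
apply: nsa_intro_surj => //; first exact: closed_subspaceT.
- by rewrite /short_ext /= /P oproj0 //; exact: nsa0 hN.
- move=> c p q Np Nq; rewrite /short_ext /= /P oproj_comb //.
  exact: (nsa_comb hN c Np Nq).
- move=> p q Np Nq; have /= := nsa_sym hN Np Nq; rewrite -/P.
  by rewrite /P oproj_sym // -oproj_sym // !oproj_id //;
    [exact: nsa_ran hN _ Nq|exact: nsa_ran hN _ Np].
- move=> p Np; have /= := nsa_ge0 hN Np; rewrite /P -oproj_sym // oproj_id //.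
  exact: nsa_ran hN _ Np.
- move=> g _; have [q Nq qg] := nsa_surj hL hN (oprojL hL g).
  have Lq := nsa_dom hN Nq.
  exists (q.1 + (g - P g), q.2).
    rewrite /short_ext /= /P oprojD // oprojD // oprojN //.
    by rewrite !(oproj_id hL (oprojL hL _)) subrr addr0 oproj_id // -surjective_pairing.
  by rewrite /= addrAC qg addrC subrK.
Qed.

Lemma short_ext_ran p : short_ext p -> L p.2.
Proof. exact: nsa_ran hN _. Qed.

(** For a pair [p] of [A] with sum [u] and a solution [r] at parameter [s] for [g = P u]: [a], [c]
    are the components of [p.1] in and off [L], [f], [y] those of [r.1], and [k] is the component of
    [p.2] off [L]. Symmetry and nonnegativity give the form inequality with error at most
    [s * sq c]. *)
Lemma short_le_aux (a c f y g k : H) (s e : R) : 0 <= s ->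
  s * (1 + (sq a + sq c)) <= e ->
  [/\ ip a c = 0, ip a y = 0 & ip a k = 0] ->
  [/\ ip f c = 0, ip f y = 0 & ip f k = 0] ->
  [/\ ip g c = 0, ip g y = 0 & ip g k = 0] ->
  ip (g - a + k) (f + y) = ip (g - f - s%:C *: y) (a + c) ->
  0 <= ip (g - a + k - (g - f - s%:C *: y)) (a + c - (f + y)) ->
  ip f (- g) <= ip (g - a + k) (a + c + (g - a + k)) - sq g + e.
Proof.
move=> s0 se [ac ay ak] [fc fy fk] [gc gy gk].
rewrite !ipE ?(ipC y a, ipC y f, ipC k a, ipC k f, ipC k g, ipC c g, ipC f g, ipC f a).
rewrite ?(ipC a g, ipC y c, ipC y k, ipC k c, ipC c a, ipC c f) ac ay ak fc fy fk gc gy gk.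
have := mulr_ge0 s0 (sq_ge0 (c - y)); have := mulr_ge0 s0 (sq_ge0 a).
have := sq_ge0 k; have := sq_ge0 (a - f).
rewrite !ipE (ipC y c) (ipC f a).
lra.
Qed.

(** Again [f], [y] are the components of [r.1], while [p] is the first component of the pair of [A]
    with sum [g + y]. By symmetry the claim follows from [0 <= s * ip y p], which nonnegativity on
    the difference provides. *)
Lemma short_max_aux (f y g p : H) (s z e : R) : 0 <= s -> 0 < e ->
  ip f y = 0 -> ip g y = 0 ->
  ip (g + y - p) (f + y) = ip (g - f - s%:C *: y) p ->
  0 <= ip (g + y - p - (g - f - s%:C *: y)) (p - (f + y)) ->
  z <= ip (g + y - p) (g + y) ->
  ip f g <= sq g - z + e.
Proof.
move=> s0 e0 fy gy.
rewrite !ipE ?(ipC y f, ipC y g, ipC p g, ipC p f, ipC p y, ipC f g) fy gy.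
have := mulr_ge0 s0 (sq_ge0 y); have := sq_ge0 (p - (f + y)).
rewrite !ipE (ipC y f) fy (ipC p f) (ipC p y).
lra.
Qed.

Lemma short_ext_le : form_le setT short_ext A.
Proof.
apply/(form_leP nsa_short_ext hA) => b p Nb Ap bp.
have Lb := short_ext_ran Nb; have [f fE fT] := nrel_limit_tends Nb.
have gE : P b.1 + b.2 = P (b.1 + b.2) by rewrite /P oprojD // (oproj_id hL Lb).
have Lg : L (P b.1 + b.2) by rewrite gE; exact: oprojL.
have -> : ip b.2 (b.1 + b.2) = ip b.2 (P b.1 + b.2).
  by rewrite gE /P -oproj_sym // oproj_id.
have : ip (P b.1) (- (P b.1 + b.2)) <= ip p.2 (p.1 + p.2) - sq (P b.1 + b.2).
  apply: (tends_ip_le _ fT) => e e0 /=.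
  have S0 : 0 < 1 + sq p.1 by have := sq_ge0 p.1; lra.
  have d0 : 0 < e / (1 + sq p.1) by rewrite divr_gt0.
  apply: (near_at_right0 d0) => s s0; rewrite ler_pdivlMr // => se.
  have [Ar rE] := fE s s0; set r := f s in Ar rE *.
  rewrite -/P in rE.
  have Pp2 : P p.2 = P b.1 + b.2 - P p.1.
    by rewrite gE bp /P oprojD // addrAC subrr add0r.
  have Og x : ip (P b.1 + b.2) (x - P x) = 0.
    by rewrite -(oproj_id hL Lg); exact: oproj_compl.
  have r2 : r.2 = P b.1 + b.2 - P r.1 - s%:C *: (r.1 - P r.1).
    by apply: ip_inj => z; rewrite -rE !ipE; ring.
  have p2 : p.2 = P b.1 + b.2 - P p.1 + (p.2 - P p.2) by rewrite -Pp2 addrC subrK.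
  have p1 : p.1 = P p.1 + (p.1 - P p.1) by rewrite addrC subrK.
  have r1 : r.1 = P r.1 + (r.1 - P r.1) by rewrite addrC subrK.
  have nd := nsa_ge0 hA (nsaB hA Ap Ar); have := nsa_sym hA Ap Ar.
  rewrite [RHS]ipC => sy.
  have := @short_le_aux (P p.1) (p.1 - P p.1) (P r.1) (r.1 - P r.1)
    (P b.1 + b.2) (p.2 - P p.2) s e (ltW s0).
  rewrite -p2 -p1 -r1 -r2 -sq_oproj //; apply => //; split; by [exact: oproj_compl|exact: Og].
by rewrite !ipE (ipC b.2 (P b.1)); lra.
Qed.

Lemma short_ext_max C : shorted_set A L C -> form_le setT C short_ext.
Proof.
move=> [hC /(form_leP hC hA) CA Cran].
have CL c : C c -> L c.2 by move=> Cc; apply: Cran; exists c.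
(* The bounded operator attached to [C] is symmetric with range in [L], so it sees only the
   projection of the sum. *)
have Cproj c c' : C c -> C c' -> P (c.1 + c.2) = P (c'.1 + c'.2) -> c.2 = c'.2.
  move=> Cc Cc' cc; have Cd := nsaB hC Cc Cc'; set d := (_, _) in Cd.
  have Ld := CL _ Cd.
  have Pd : P (d.1 + d.2) = 0.
    have -> : d.1 + d.2 = c.1 + c.2 - (c'.1 + c'.2).
      by apply: ip_inj => z; rewrite /d !ipE; ring.
    by rewrite /P oprojD // oprojN // -/P cc subrr.
  have := nsa_ge0 hC Cd; have : ip d.2 (d.1 + d.2) = 0.
    by rewrite -[X in ip X _](oproj_id hL Ld) oproj_sym // -/P Pd ip0r.
  rewrite ipDr => h1 h2; apply/eqP; rewrite -subr_eq0; apply/eqP/sq_eq0.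
  have d2 : sq d.2 <= 0 by lra.
  by apply/le_anti; rewrite sq_ge0 andbT.
apply/(form_leP hC nsa_short_ext) => c b Cc Nb cb.
have Lb := short_ext_ran Nb; have [f fE fT] := nrel_limit_tends Nb.
have gE : P b.1 + b.2 = P (b.1 + b.2) by rewrite /P oprojD // (oproj_id hL Lb).
have Lg : L (P b.1 + b.2) by rewrite gE; exact: oprojL.
have -> : ip b.2 (b.1 + b.2) = ip b.2 (P b.1 + b.2).
  by rewrite gE /P -oproj_sym // oproj_id.
have -> : ip c.2 (c.1 + c.2) = ip c.2 (P b.1 + b.2).
  by rewrite cb gE /P -oproj_sym // oproj_id //; exact: CL.
have : ip (P b.1) (P b.1 + b.2) <= sq (P b.1 + b.2) - ip c.2 (P b.1 + b.2).
  apply: (tends_ip_le _ fT) => e e0 /=.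
  apply: (near_at_right0 ltr01) => s s0 _.
  have [Ar rE] := fE s s0; set r := f s in Ar rE *; rewrite /= in rE.
  (* The short of [X] has at [g] the quadratic form [inf (X h, h)] over [h] with [P h = g]; this
     [h], built from the solution at [s], approaches the infimum. *)
  pose h := P b.1 + b.2 + (r.1 - P r.1).
  have Ph : P h = P b.1 + b.2.
    rewrite /h /P oprojD // (oproj_id hL Lg) oprojD // oprojN //.
    by rewrite (oproj_id hL (oprojL hL _)) subrr addr0.
  have [c' Cc' c'h] := nsa_surj closed_subspaceT hC (I : setT h).
  have [p Ap ph] := nsa_surj closed_subspaceT hA (I : setT h).
  have := CA _ _ Cc' Ap (etrans c'h (esym ph)).
  rewrite c'h -(Cproj c c') //; last by rewrite c'h Ph cb -gE.
  have -> : ip c.2 h = ip c.2 (P b.1 + b.2).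
    by rewrite -[in LHS](oproj_id hL (CL _ Cc)) oproj_sym // -/P Ph.
  have Og x : ip (P b.1 + b.2) (x - P x) = 0.
    by rewrite -(oproj_id hL Lg); exact: oproj_compl.
  have nd := nsa_ge0 hA (nsaB hA Ap Ar); have := nsa_sym hA Ap Ar.
  rewrite [RHS]ipC => sy.
  have r2 : r.2 = P b.1 + b.2 - P r.1 - s%:C *: (r.1 - P r.1).
    by apply: ip_inj => z; rewrite -rE !ipE; ring.
  have r1 : r.1 = P r.1 + (r.1 - P r.1) by rewrite addrC subrK.
  have p2 : p.2 = P b.1 + b.2 + (r.1 - P r.1) - p.1.
    by rewrite -[X in X - _]ph addrAC subrr add0r.
  move=> ch; have := @short_max_aux (P r.1) (r.1 - P r.1) (P b.1 + b.2) p.1 s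
    (ip c.2 (P b.1 + b.2)) e (ltW s0) e0.
  by rewrite -p2 -r1 -r2; apply => //; [exact: oproj_compl|rewrite -/h -[X in ip p.2 X]ph].
by rewrite !ipE (ipC b.2 (P b.1)); lra.
Qed.

End Short.

End LimitRelation.

(** * The shorted relation and the function M *)

Section ShortedRelation.
Context {R : realType} {H : hilbertType R}.
Implicit Types (A B C : set (H * H)) (L K : set H).

(** The two inequalities equate the quadratic forms [(X u, u)]; polarization and the symmetry of the
    relations then equate the operators. *)
Lemma form_le_anti A B : nonneg_selfadjoint setT A -> nonneg_selfadjoint setT B ->
  form_le setT A B -> form_le setT B A -> A = B.
Proof.
move=> hA hB /(form_leP hA hB) AB /(form_leP hB hA) BA.
suff key p q : A p -> B q -> p.1 + p.2 = q.1 + q.2 -> p = q.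
  apply/seteqP; split=> [p Ap|q Bq].
    by have [q Bq /esym pq] := nsa_surj closed_subspaceT hB (I : setT (p.1 + p.2));
      rewrite (key p q).
  by have [p Ap pq] := nsa_surj closed_subspaceT hA (I : setT (q.1 + q.2));
    rewrite -(key p q).
move=> Ap Bq pq.
have quad r t : A r -> B t -> r.1 + r.2 = t.1 + t.2 ->
    ip r.2 (r.1 + r.2) = ip t.2 (t.1 + t.2).
  by move=> Ar Bt rt; apply/le_anti; rewrite AB // BA.
have e2 : p.2 = q.2.
  apply: ip_inj => z.
  have [r Ar rz] := nsa_surj closed_subspaceT hA (I : setT z).
  have [t Bt tz] := nsa_surj closed_subspaceT hB (I : setT z).
  have rt : r.1 + r.2 = t.1 + t.2 by rewrite rz tz.
  have := quad _ _ (nsaD hA Ap Ar) (nsaD hB Bq Bt); rewrite /=.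
  have -> : p.1 + r.1 + (p.2 + r.2) = (p.1 + p.2) + z by rewrite addrACA rz.
  have -> : q.1 + t.1 + (q.2 + t.2) = (p.1 + p.2) + z by rewrite addrACA tz pq.
  move=> /(_ erefl).
  have := quad _ _ Ap Bq pq; have := quad _ _ Ar Bt rt.
  have := nsa_sym hA Ap Ar; have := nsa_sym hB Bq Bt.
  rewrite rz tz -pq.
  have : ip r.2 (p.1 + p.2) = ip p.2 z + (ip r.2 p.1 - ip p.2 r.1).
    by rewrite -rz !ipE (ipC r.2 p.2); ring.
  have : ip t.2 (p.1 + p.2) = ip q.2 z + (ip t.2 q.1 - ip q.2 t.1).
    by rewrite pq -tz !ipE (ipC t.2 q.2); ring.
  rewrite !(ipDl, ipDr _ z) (ipC p.1 r.2) (ipC q.1 t.2).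
  lra.
by move: pq; rewrite (surjective_pairing p) (surjective_pairing q) /= e2 => /addIr ->.
Qed.

(** The extended limit is greatest in [shorted_set A L]; the maximal element picked by [get] lies
    below it, hence equals it. *)
Lemma shorted_spec A L : nonneg_selfadjoint setT A -> closed_subspace L ->
  [/\ shorted_set A L (shorted A L), nonneg_selfadjoint L (rrestr (shorted A L) L)
    & is_nrel_limit A L (rrestr (shorted A L) L)].
Proof.
move=> hA hL; have [N hN Nlim] := nrel_limit hA hL.
pose B := short_ext L N; have hB := nsa_short_ext hL hN.
have BA : shorted_set A L B.
  split => //; first exact: short_ext_le.
  by move=> _ [p Bp <-]; exact: short_ext_ran hN _ Bp.
have Bmax C : shorted_set A L C -> form_le setT C B by exact: short_ext_max.
have [SA Smax] : shorted_set A L (shorted A L) /\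
    forall C, shorted_set A L C -> form_le setT (shorted A L) C -> C = shorted A L.
  apply: (@getPex _ [set B | shorted_set A L B /\
    forall C, shorted_set A L C -> form_le setT B C -> C = B]).
  exists B; split => // C CA BC; have [hC _ _] := CA.
  by apply: form_le_anti => //; exact: Bmax.
rewrite -(Smax B BA (Bmax _ SA)).
suff -> : rrestr B L = N by [].
apply/seteqP; split => p.
  by move=> [Bp Lp]; move: Bp; rewrite /B /short_ext /= oproj_id // -surjective_pairing.
move=> Np; have Lp := nsa_dom hN Np; split => //.
by rewrite /B /short_ext /= oproj_id // -surjective_pairing.
Qed.

(** For [g] in [L], a pair [(f, f')] of [A] with [f' + s f = g] satisfies the condition off [L].
    Inverting the compression gives [(P f, g)], and the shift subtracts [s P f] from [g], leaving
    [P f']. *)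
Lemma ropp_Mfun A L (t : R) : nonneg_selfadjoint setT A -> closed_subspace L -> t < 0 ->
  ropp (Mfun A L t%:C) = nrel A L (- t).
Proof.
move=> hA hL t0; set s := - t; have s0 : 0 < s by rewrite oppr_gt0.
have tE : t%:C = - s%:C by rewrite /s rmorphN opprK.
have res p : A p -> resolvent setT A t%:C (p.2 + s%:C *: p.1) = p.1.
  by move=> Ap; rewrite tE; apply: resolventE => //; exact: closed_subspaceT.
have ss : 0 < Num.sqrt s by rewrite sqrtr_gt0.
apply/seteqP; split => q.
  move=> [[r1 r2] /= [/= Lr r1E] [q1 q2]].
  have [p Ap pE] := weighted_surj (- r2) hA hL ss ss.
  rewrite -scalerDr addrCA subrr addr0 sqr_sqrtr in pE; last exact: ltW.
  have e1 : q.1 = oproj L p.1 by rewrite -q1 r1E -pE res.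
  have e2 : oproj L p.2 + s%:C *: oproj L p.1 = - r2.
    by rewrite -oprojZ // -oprojD // pE oproj_id.
  have e3 : q.2 = oproj L p.2.
    move: q2; rewrite tE opprK q1 e1 => q2; apply: ip_inj => z.
    have := congr1 (fun w => ip w z) q2; have := congr1 (fun w => ip w z) e2.
    by rewrite !ipE; lra.
  exists p => //; split; first by rewrite -e1 -e3 -surjective_pairing.
  by apply: ip_inj => z; have := congr1 (fun w => ip w z) (etrans e2 (esym pE)); rewrite !ipE; lra.
move=> [p Ap [-> pE]].
have e : p.2 + s%:C *: p.1 = oproj L p.2 + s%:C *: oproj L p.1.
  by apply: ip_inj => z; have := congr1 (fun w => ip w z) pE; rewrite !ipE; lra.
exists (oproj L p.1, - (oproj L p.2 + s%:C *: oproj L p.1)).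
  split; rewrite /= opprK.
    by apply: subspaceD => //; [exact: oprojL|apply: subspaceZ => //; exact: oprojL].
  by rewrite -e res.
by rewrite /= tE opprK opprD subrK.
Qed.

Lemma nrel_rinv A L (s : R) : 0 < s -> nrel A L s = rinv (nrel (rinv A) L s^-1).
Proof.
move=> s0; have key (x y : H) : (y = - (s%:C *: x)) <-> (x = - (s^-1%:C *: y)).
  split=> ->; rewrite scalerN opprK scalerA -rmorphM.
    by rewrite mulVf ?gt_eqF // scale1r.
  by rewrite mulfV ?gt_eqF // scale1r.
apply/seteqP; split=> q.
  move=> [p Ap [-> /key pE]]; exists (p.2, p.1) => //.
  by rewrite /rinv /= -surjective_pairing.
move=> [p Ap [[q2 q1] /key pE]]; exists (p.2, p.1) => //.
by split => //=; rewrite (surjective_pairing q) q1 q2.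
Qed.

End ShortedRelation.

Theorem theorem3p3 (R : realType) (H : hilbertType R)
    (A : set (H * H)) (L : set H)
    (hA : nonneg_selfadjoint setT A) (hL : closed_subspace L) :
  [/\ form_le setT (shorted A L) (rinv (shorted (rinv A) L)),
      is_sRlim L (0 : R)^'- (fun t : R => ropp (Mfun A L t%:C))
        (rrestr (shorted A L) L) &
      is_sRlim L (-oo : set_system R) (fun t : R => ropp (Mfun A L t%:C))
        (rinv (rrestr (shorted (rinv A) L) L))].
Proof.
have hT := @closed_subspaceT R H; have hA' := nsa_rinv hT hA.
have [[hB BA _] hN Nlim] := shorted_spec hA hL.
have [[hC CA _] hN' Nlim'] := shorted_spec hA' hL.
have hM (t : R) : t < 0 -> nonneg_selfadjoint L (ropp (Mfun A L t%:C)).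
  by move=> t0; rewrite ropp_Mfun //; apply: nsa_nrel => //; rewrite oppr_gt0.
split.
- apply/(form_leP hB (nsa_rinv hT hC)) => p q Bp Cq pq.
  (* With [u] the common sum, maximal shorts give [(p.2, u) <= (a.2, u)] and [(q.1, u) <= (a.1, u)];
     then [a.1 + a.2 = q.1 + q.2] yields the claim. *)
  have [a Aa aE] := nsa_surj hT hA (I : setT (p.1 + p.2)).
  have := (form_leP hB hA).1 BA _ _ Bp Aa (esym aE).
  have := (form_leP hC hA').1 CA _ (a.2, a.1) Cq; rewrite /rinv /= -surjective_pairing.
  rewrite addrC -pq [a.2 + _]addrC aE => /(_ Aa erefl).
  have : ip a.1 (p.1 + p.2) + ip a.2 (p.1 + p.2) = ip q.1 (p.1 + p.2) + ip q.2 (p.1 + p.2).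
    by rewrite -!ipDl aE pq.
  by lra.
- split => //; first by near=> t; apply: hM; near: t; exact: nbhs_left_lt.
  move=> g Lg; apply: nearP_sq => e e0.
  have [q Nq qg] := nsa_surj hL hN Lg; have [d d0 dE] := Nlim _ Nq _ e0.
  near=> t; have t0 : t < 0 by near: t; exact: nbhs_left_lt.
  have [p Mp pg] := nsa_surj hL (hM t t0) Lg.
  have := resolvent1E hL (hM t t0) Mp; rewrite pg => ->.
  have := resolvent1E hL hN Nq; rewrite qg => ->.
  rewrite ropp_Mfun // in Mp; apply: (dE (- t)) => //; rewrite ?oppr_gt0 // ?pg //.
  by rewrite lerNl; near: t; apply: nbhs_left_ge; rewrite oppr_lt0.
- split; first by near=> t; apply: hM; near: t; exact: nbhs_ninfty_lt.
    exact: nsa_rinv.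
  move=> g Lg; apply: nearP_sq => e e0.
  have [q Nq qg] := nsa_surj hL hN' Lg; have [d d0 dE] := Nlim' _ Nq _ e0.
  near=> t; have t0 : t < 0 by near: t; exact: nbhs_ninfty_lt.
  have [p Mp pg] := nsa_surj hL (hM t t0) Lg.
  have hNi := nsa_rinv hL hN'.
  have qi : rinv (rrestr (shorted (rinv A) L) L) (q.2, q.1).
    by rewrite /rinv /= -surjective_pairing.
  have := resolvent1E hL hNi qi; rewrite /= addrC qg => ->.
  have := resolvent1E hL (hM t t0) Mp; rewrite pg => ->.
  rewrite ropp_Mfun // nrel_rinv ?oppr_gt0 // in Mp.
  (* The parameter for [rinv A] is [(- t)^-1], small as [t] tends to [-oo]. Inversion exchanges the
     components, and since the sums agree their errors are opposite. *)
  have : sq (p.2 - q.1) < e.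
    apply: (dE (- t)^-1 (p.2, p.1)) => //; rewrite ?invr_gt0 ?oppr_gt0 //.
    - rewrite invf_ple ?posrE ?oppr_gt0 // lerNr; near: t.
      by apply: nbhs_ninfty_le; rewrite num_real.
    - by rewrite /= addrC pg qg.
  have -> : p.2 - q.1 = - (p.1 - q.2).
    by apply: ip_inj => z; have := congr1 (fun w => ip w z) (etrans pg (esym qg));
      rewrite !ipE; lra.
  by rewrite ipNl ipNr opprK.
Unshelve. all: by end_near. Qed.
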